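(* Let $F:\mathbb R^n\rightrightarrows\mathbb R^n$ be a multifunction with nonempty, convex, compact values which is Lipschitz continuous, i.e. there is $K>0$ with $F(x_2)\subseteq F(x_1)+K\|x_1-x_2\|\mathbb B^n$ for all $x_1,x_2$. Let $H(x,p)=\sup_{v\in F(x)}\langle p,v\rangle$ and assume: (H1) there is $c_0\ge 0$ such that for every $p\in\mathbb R^n$ the map $x\mapsto H(x,p)$ is semiconvex with semiconvexity constant $c_0\|p\|$; (H2) for every $p\neq 0$ the gradient $\nabla_pH(x,p)$ exists for all $x$ and there is $K_1\ge 0$ with $\|\nabla_pH(x,p)-\nabla_pH(y,p)\|\le K_1\|x-y\|$ for all $x,y\in\mathbb R^n$, $p\neq 0$. Let $\mathcal S\subseteq\mathbb R^n$ be closed and let $T$ be the associated minimum time function. Let $x\in\mathbb R^n\setminus\mathcal S$ with $T(x)<\infty$, let $x(\cdot)$ be an optimal trajectory starting from $x$ and reaching $\mathcal S$ at time $T(x)$, set $\bar x=x(T(x))$, and let $\xi$ be a unit vector in $N^P_{\overline{\mathbb R^n\setminus\mathcal S}}(\bar x)$ (a unit proximal inner normal to $\mathcal S$ at $\bar x$). Let $p:[0,T(x)]\to\mathbb R^n$ be an absolutely continuous arc with $p(t)\ne 0$ for all $t$ such that $$\dot x(t)=F_{p(t)}(x(t)),\qquad -\dot p(t)\in\partial_xH(x(t),p(t))\qquad\text{for a.e. } t\in[0,T(x)].$$ Then: (i) if $H(\bar x,\xi)\neq 0$ and $p(T(x))=\xi/H(\bar x,\xi)$, then $-p(t)\in\partial^PT(x(t))$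 for all $t\in[0,T(x))$; (ii) if $H(\bar x,\xi)=0$ and $p(T(x))=\xi$, then $-p(t)\in\partial^\infty T(x(t))$ for all $t\in[0,T(x))$.
   Context: Trajectories of $\dot x\in F(x)$ are absolutely continuous arcs $y(\cdot)$ with $\dot y(t)\in F(y(t))$ a.e. The minimum time function is $T(x)=\inf\{\tau>0:\ \exists$ a trajectory $y$ with $y(0)=x$, $y(\tau)\in\mathcal S\}$ (with $\inf\emptyset=+\infty$); an optimal trajectory from $x$ is a trajectory $x(\cdot)$ with $x(0)=x$ and $x(T(x))\in\mathcal S$. For $p\ne 0$, $F_p(x):=\nabla_pH(x,p)$. $\partial_xH(x,p)$ denotes Clarke's generalized gradient of $H(\cdot,p)$ at $x$. A vector $v$ is a proximal normal to a closed set $Q$ at $z\in Q$, written $v\in N^P_Q(z)$, if there is $\sigma\ge0$ with $\langle v,y-z\rangle\le\sigma\|y-z\|^2$ for all $y\in Q$. For an upper semicontinuous $f$, with $\mathrm{hypo} f=\{(y,\alpha):\alpha\le f(y)\}$: $\partial^Pf(y)=\{\zeta:(-\zeta,1)\in N^P_{\mathrm{hypo} f}(y,f(y))\}$ (proximal supergradients) and $\partial^\infty f(y)=\{\zeta:(-\zeta,0)\in N^P_{\mathrm{hypo} f}(y,f(y))\}$ (horizontal proximal supergradients). A function $h$ is semiconvex with constant $c$ if $-h$ is continuous and satisfies $\frac{-h(x_1)-h(x_2)}2+h(\frac{x_1+x_2}2)\le\frac c4\|x_1-x_2\|^2$. *)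

(* Defs.v *)
From HB Require Import structures.
From mathcomp Require Import all_boot all_order all_algebra.
From mathcomp Require Import all_classical all_reals all_analysis.
Set Implicit Arguments. Unset Strict Implicit. Unset Printing Implicit Defensive.
Import Order.TTheory GRing.Theory Num.Theory.
Import numFieldNormedType.Exports.
Local Open Scope classical_set_scope.
Local Open Scope ring_scope.

Section Defs.
Variable R : realType.
Variable n : nat.
Local Notation V := 'rV[R]_n.

Definition edot (u v : V) : R := \sum_(i < n) u ord0 i * v ord0 i.
Definition enorm (u : V) : R := Num.sqrt (edot u u).

Definition convex_set_rV (A : set V) : Prop :=
  forall u v l, A u -> A v -> 0 <= l <= 1 -> A (l *: u + (1 - l) *: v).

Definition lipschitz_multi (F : V -> set V) (K : R) : Prop :=
  forall x1 x2 v, F x2 v -> exists2 w, F x1 w & enorm (v - w) <= K * enorm (x1 - x2).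

Definition Ham (F : V -> set V) (x p : V) : R := sup [set edot p v | v in F x].

Definition semiconvex (h : V -> R) (c : R) : Prop :=
  continuous (fun x => - h x) /\
  forall x1 x2, (- h x1 - h x2) / 2 + h ((2:R)^-1 *: (x1 + x2))
                <= c / 4 * enorm (x1 - x2) ^+ 2.

Definition grad_at (g : V -> R) (p d : V) : Prop :=
  forall eps : R, 0 < eps -> exists2 delta : R, 0 < delta &
    forall h : V, enorm h < delta ->
      `|g (p + h) - g p - edot d h| <= eps * enorm h.

Definition clarke_dd (g : V -> R) (x v : V) : \bar R :=
  ereal_inf [set ereal_sup [set r : \bar R | exists (y : V) (t : R),
                   [/\ enorm (y - x) < delta, 0 < t < delta &
                       r = ((g (y + t *: v) - g y) / t)%:E]]
            | delta in [set delta : R | 0 < delta]].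

Definition clarke_grad (g : V -> R) (x : V) : set V :=
  [set zeta | forall v, ((edot zeta v)%:E <= clarke_dd g x v)%E].

Definition abs_cont_arc (f : R -> V) (a b : R) : Prop :=
  forall eps : R, 0 < eps -> exists2 delta : R, 0 < delta &
    forall (k : nat) (s t : nat -> R),
      (forall i, (i < k)%N -> a <= s i /\ s i <= t i /\ t i <= b) ->
      (forall i j, (i < k)%N -> (j < k)%N -> i <> j -> t i <= s j \/ t j <= s i) ->
      \sum_(i < k) (t i - s i) < delta ->
      \sum_(i < k) enorm (f (t i) - f (s i)) < eps.

Definition trajectory (F : V -> set V) (y : R -> V) (tau : R) : Prop :=
  abs_cont_arc y 0 tau /\
  {ae (@lebesgue_measure R), forall t, t \in `[0, tau] ->
      exists2 d, is_derive t 1 y d & F (y t) d}.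

Definition min_time (F : V -> set V) (S : set V) (x : V) : \bar R :=
  ereal_inf [set tau%:E | tau in [set tau : R | 0 < tau /\
     exists y, trajectory F y tau /\ y 0 = x /\ S (y tau)]].

Definition prox_normal (Q : set V) (z v : V) : Prop :=
  Q z /\ exists2 sigma : R, 0 <= sigma &
    forall y, Q y -> edot v (y - z) <= sigma * enorm (y - z) ^+ 2.

Definition prox_normal2 (Q : set (V * R)) (z v : V * R) : Prop :=
  Q z /\ exists2 sigma : R, 0 <= sigma &
    forall y, Q y ->
      edot v.1 (y.1 - z.1) + v.2 * (y.2 - z.2)
        <= sigma * (enorm (y.1 - z.1) ^+ 2 + (y.2 - z.2) ^+ 2).

Definition hypo (f : V -> \bar R) : set (V * R) :=
  [set ya | (ya.2%:E <= f ya.1)%E].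

Definition prox_supergrad (f : V -> \bar R) (y : V) : set V :=
  [set zeta | f y \is a fin_num /\ prox_normal2 (hypo f) (y, fine (f y)) (- zeta, 1)].
Definition hzn_prox_supergrad (f : V -> \bar R) (y : V) : set V :=
  [set zeta | f y \is a fin_num /\ prox_normal2 (hypo f) (y, fine (f y)) (- zeta, 0)].

End Defs.

(* Main.v *)
Require Import Defs.
From HB Require Import structures.
From mathcomp Require Import all_boot all_order all_algebra.
From mathcomp Require Import all_classical all_reals all_analysis.
From mathcomp Require Import measurable_realfun ring lra.
Import Order.TTheory GRing.Theory Num.Theory.
Import numFieldNormedType.Exports.
Local Open Scope classical_set_scope.
Local Open Scope ring_scope.

(* The arc [p] is propagated backwards from the normal [xi] at the endpoint.  For [y] near
   [x(t)] let [Y] solve [Y' = F_p(Y)] from [y], with [p] frozen past the final time.  Since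
   [H(., p)] is semiconvex, [-p'] in its Clarke gradient is a subgradient up to a quadratic
   term, so [<p, Y - x>] decreases by at most [O(|y - x(t)|^2)] along the flow (Gronwall
   gives [|Y - x| = O(|y - x(t)|)]).  If [alpha <= T(y)], then [Y] at time [alpha] is in the
   closure of the complement of [S], where the normal inequality bounds [<xi, Y - xbar>] from
   above by a quadratic term; running [Y] from the final time of [x] to time [alpha] changes
   [<xi, Y>] by [H(xbar, xi)] times the time difference, again up to a quadratic term.
   Adding the two estimates gives the proximal inequality, with second component
   [H(xbar, p(T))], that is [1] in case (i) and [0] in case (ii).  In case (i) one also needs
   [H(xbar, xi) >= 0], which holds because the optimal arc reaches [S] from outside. *)

(** Freezing the adjoint past the final time settles an asymmetry. If [alpha] exceeds the final
    time, a lower bound on the increment of [<p(T), Y>] requires velocities that actually maximize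
    against [p(T)], and freezing provides them. If [alpha] is smaller, the increment is run
    backwards and only [<p(T), v> <= H] is needed, although [v] maximizes against another vector
    there. The flow must exist from every [y], so its velocity has to be continuous in time as well
    as Lipschitz in space; the former comes from differentiability of [H(y, .)], which makes the
    maximizer depend continuously on [p]. The proximal inequality is demanded on the whole
    hypograph, where [T(y)] may be infinite and [alpha] arbitrarily negative. Flow estimates are
    therefore used only near the base point; elsewhere the quadratic term dominates by itself. Both
    cases are one statement with [p(T) = l xi], [l >= 0]: the sign of [l] keeps the normal
    inequality in the right direction, whence the interest in the sign of [H(xbar, xi)]. *)

Set Implicit Arguments.
Unset Strict Implicit.
Unset Printing Implicit Defensive.

(** * Euclidean norm *)

Section Euclid.
Context {R : realType} {n : nat}.
Local Notation V := 'rV[R]_n.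
Implicit Types u v w : V.

Lemma edotC u v : edot u v = edot v u.
Proof. by apply: eq_bigr => i _; rewrite mulrC. Qed.

Lemma edotDl u v w : edot (u + v) w = edot u w + edot v w.
Proof. by rewrite -big_split; apply: eq_bigr => i _; rewrite mxE mulrDl. Qed.

Lemma edotZl (a : R) u v : edot (a *: u) v = a * edot u v.
Proof. by rewrite /edot mulr_sumr; apply: eq_bigr => i _; rewrite mxE mulrA. Qed.

Lemma edotDr u v w : edot w (u + v) = edot w u + edot w v.
Proof. by rewrite edotC edotDl !(edotC w). Qed.

Lemma edotZr (a : R) u v : edot u (a *: v) = a * edot u v.
Proof. by rewrite edotC edotZl edotC. Qed.

Lemma edotNl u v : edot (- u) v = - edot u v.
Proof. by rewrite -scaleN1r edotZl mulN1r. Qed.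

Lemma edotNr u v : edot u (- v) = - edot u v.
Proof. by rewrite edotC edotNl edotC. Qed.

Lemma edot0l u : edot 0 u = 0.
Proof. by rewrite -(scale0r u) edotZl mul0r. Qed.

Lemma edot0r u : edot u 0 = 0.
Proof. by rewrite edotC edot0l. Qed.

Definition edotE := (edotDl, edotDr, edotNl, edotNr, edotZl, edotZr).

Lemma edotvv_ge0 u : 0 <= edot u u.
Proof. by apply: sumr_ge0 => i _; rewrite -expr2 sqr_ge0. Qed.

Lemma edotvv_eq0 u : edot u u = 0 -> u = 0.
Proof.
move=> /eqP; rewrite psumr_eq0; last by move=> i _; rewrite -expr2 sqr_ge0.
move=> /allP h; apply/rowP => i; rewrite mxE.
by have := h i (mem_index_enum _); rewrite -expr2 sqrf_eq0 => /eqP.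
Qed.

Lemma enorm_ge0 u : 0 <= enorm u.
Proof. exact: sqrtr_ge0. Qed.

Lemma sqr_enorm u : enorm u ^+ 2 = edot u u.
Proof. by rewrite sqr_sqrtr// edotvv_ge0. Qed.

Lemma enorm0 : enorm (0 : V) = 0.
Proof. by rewrite /enorm edot0l sqrtr0. Qed.

Lemma enorm_eq0 u : enorm u = 0 -> u = 0.
Proof. by move=> u0; apply: edotvv_eq0; rewrite -sqr_enorm u0 expr0n. Qed.

Lemma enorm_gt0 u : u != 0 -> 0 < enorm u.
Proof.
by move=> u0; rewrite lt_neqAle enorm_ge0 andbT eq_sym; apply: contra u0 => /eqP /enorm_eq0 ->.
Qed.

Lemma enormZ (a : R) u : enorm (a *: u) = `|a| * enorm u.
Proof. by rewrite /enorm edotZl edotZr mulrA -expr2 sqrtrM ?sqr_ge0// sqrtr_sqr. Qed.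

Lemma enormN u : enorm (- u) = enorm u.
Proof. by rewrite -scaleN1r enormZ normrN1 mul1r. Qed.

Lemma enormB u v : enorm (u - v) = enorm (v - u).
Proof. by rewrite -enormN opprB. Qed.

(** Cauchy-Schwarz: with [a], [b] the norms of [u], [v], the square of [b *: u - a *: v] equals
    [2ab (ab - edot u v)]. *)
Lemma edot_le u v : edot u v <= enorm u * enorm v.
Proof.
have [->|u0] := eqVneq u 0; first by rewrite edot0l enorm0 mul0r.
have [->|v0] := eqVneq v 0; first by rewrite edot0r enorm0 mulr0.
have a0 := enorm_gt0 u0; have b0 := enorm_gt0 v0.
have := edotvv_ge0 (enorm v *: u - enorm u *: v).
rewrite !edotE -!sqr_enorm (edotC v u).
set a := enorm u in a0 *; set b := enorm v in b0 *; set e := edot u v.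
rewrite (_ : _ + _ = 2 * (a * b) * (a * b - e)); last by ring.
by rewrite pmulr_rge0 ?subr_ge0// !mulr_gt0.
Qed.

Lemma normr_edot_le u v : `|edot u v| <= enorm u * enorm v.
Proof. by rewrite ler_norml edot_le andbT lerNl -edotNl -[enorm u]enormN edot_le. Qed.

Lemma enormD u v : enorm (u + v) <= enorm u + enorm v.
Proof.
rewrite -(@ler_pXn2r _ 2)// ?nnegrE ?addr_ge0 ?enorm_ge0//.
rewrite sqr_enorm !edotE sqrrD !sqr_enorm (edotC v u).
by have := edot_le u v; lra.
Qed.

Lemma enorm_dist u v w : enorm (u - w) <= enorm (u - v) + enorm (v - w).
Proof. by rewrite -(subrKA v u) enormD. Qed.

Lemma coord_le_enorm u i : `|u ord0 i| <= enorm u.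
Proof.
rewrite -(@ler_pXn2r _ 2)// ?nnegrE ?enorm_ge0// sqr_enorm real_normK ?num_real//.
rewrite /edot (bigD1 i)//= -expr2 lerDl.
by apply: sumr_ge0 => j _; rewrite -expr2 sqr_ge0.
Qed.

Lemma norm_le_enorm u : `|u| <= enorm u.
Proof.
rewrite /Num.Def.normr/= mx_normrE; apply: bigmax_le; first exact: enorm_ge0.
by move=> [i j] _ /=; rewrite ord1; exact: coord_le_enorm.
Qed.

Lemma coord_le_norm u i : `|u ord0 i| <= `|u|.
Proof.
by rewrite [leRHS]/Num.Def.normr/= mx_normrE; apply/bigmax_geP; right => /=; exists (ord0, i).
Qed.

(** The crude constant [n.+1] stays positive in dimension 0, so that radii may be divided by it. *)
Lemma enorm_le_norm u : enorm u <= n.+1%:R * `|u|.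
Proof.
rewrite -(@ler_pXn2r _ 2)// ?nnegrE ?enorm_ge0 ?mulr_ge0//.
rewrite sqr_enorm /edot (@le_trans _ _ (\sum_(i < n) `|u| ^+ 2))//.
  apply: ler_sum => i _; rewrite -expr2 -real_normK ?num_real//.
  by rewrite ler_pXn2r ?nnegrE// coord_le_norm.
rewrite sumr_const card_ord exprMn -[leLHS]mulr_natl ler_wpM2r ?sqr_ge0//.
by rewrite -natrX ler_nat -mulnn mulSn (leq_trans (leqnSn n))// leq_addr.
Qed.

(** The topology on row vectors comes from the sup norm; by equivalence of norms, neighbourhoods and
    hence continuity can be tested with Euclidean balls. *)
Lemma nbhs_enormP u (A : set V) :
  nbhs u A <-> exists2 d : R, 0 < d & forall v, enorm (v - u) < d -> A v.
Proof.
split=> [/nbhs_ballP[/= e e0 eA]|[d d0 dA]].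
  exists e => // v vu; apply: eA; rewrite -ball_normE /=.
  by rewrite (le_lt_trans (norm_le_enorm _))// enormB.
apply/nbhs_ballP; exists (d / n.+1%:R); first by rewrite /= divr_gt0.
move=> v; rewrite -ball_normE /= => uv; apply: dA; rewrite enormB.
by rewrite (le_lt_trans (enorm_le_norm _))// mulrC -ltr_pdivlMr.
Qed.

Lemma continuous_enormP (T : topologicalType) (f : T -> V) (t : T) :
  {for t, continuous f} <->
  forall e : R, 0 < e -> \forall s \near t, enorm (f s - f t) < e.
Proof.
split=> [cf e e0|cf A /nbhs_enormP[d d0 dA]].
  by apply: (cf [set v | enorm (v - f t) < e]); apply/nbhs_enormP; exists e.
by apply: filterS (cf d d0) => s; exact: dA.
Qed.

Lemma continuous_realP (g : V -> R) u :
  {for u, continuous g} <->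
  forall e : R, 0 < e -> exists2 d : R, 0 < d &
    forall v, enorm (v - u) < d -> `|g v - g u| < e.
Proof.
have gP := @cvgrPdist_lt R R V (nbhs u) (nbhs_filter u) g (g u).
split=> [/(iffLR gP) cg e /cg/(iffLR (nbhs_enormP _ _))[d d0 dP]|cg].
  by exists d => // v /dP; rewrite distrC.
apply: (iffRL gP) => e /cg[d d0 dP]; apply: (iffRL (nbhs_enormP _ _)).
by exists d => // v /dP; rewrite distrC.
Qed.

Lemma continuous_enorm : continuous (@enorm R n).
Proof.
move=> u; apply/continuous_realP => e e0; exists e => // v; apply: le_lt_trans.
rewrite ler_norml.
have := enormD (v - u) u; have := enormD (u - v) v; rewrite !subrK (enormB u v).
by move=> ? ?; apply/andP; split; lra.
Qed.

Lemma continuous_edot (T : topologicalType) (f g : T -> V) (t : T) :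
  {for t, continuous f} -> {for t, continuous g} ->
  {for t, continuous (fun s => edot (f s) (g s))}.
Proof.
move=> cf cg; apply: cvg_big => [|i _]; first exact: add_continuous.
apply: cvgM.
  exact: (cvg_comp _ _ cf (@coord_continuous _ _ _ ord0 i (f t))).
exact: (cvg_comp _ _ cg (@coord_continuous _ _ _ ord0 i (g t))).
Qed.

End Euclid.

(** * Absolutely continuous functions *)

Section AbsCont.
Context {R : realType}.
Local Notation mu := (@lebesgue_measure R).

Lemma is_derive_eps (W : normedModType R) (f : R -> W) (t : R) (d : W) :
  is_derive t 1 f d -> forall e : R, 0 < e -> exists2 r : R, 0 < r &
    forall h, `|h| < r -> `|f (t + h) - f t - h *: d| <= e * `|h|.
Proof.
move=> [+ <-] e e0; rewrite /derivable /derive => /cvgrPdist_le /(_ e e0).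
rewrite -/('D_1 f t) => /nbhs_ballP[r /= r0 rB]; exists r => // h hr.
have [->|h0] := eqVneq h 0.
  by rewrite addr0 subrr scale0r subr0 !normr0 mulr0.
have := rB h; rewrite -ball_normE /= sub0r normrN => /(_ hr h0).
rewrite [h *: 1]mulr1 [h + t]addrC -(ler_pM2r (_ : 0 < `|h|)) ?normr_gt0//.
by rewrite mulrC -normrZ scalerDr scalerN scalerA divff// scale1r distrC.
Qed.

(** Scalar version of [abs_cont_arc]; estimates on arcs are reduced to such functions. *)
Definition abs_cont (f : R -> R) (a b : R) : Prop :=
  forall eps : R, 0 < eps -> exists2 delta : R, 0 < delta &
    forall (k : nat) (s t : nat -> R),
      (forall i, (i < k)%N -> a <= s i /\ s i <= t i /\ t i <= b) ->
      (forall i j, (i < k)%N -> (j < k)%N -> i <> j -> t i <= s j \/ t j <= s i) ->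
      \sum_(i < k) (t i - s i) < delta ->
      \sum_(i < k) `|f (t i) - f (s i)| < eps.

Lemma abs_cont_dist (f : R -> R) (a b : R) : abs_cont f a b ->
  forall e : R, 0 < e -> exists2 r : R, 0 < r &
    forall s t, a <= s -> s <= t -> t <= b -> t - s < r -> `|f t - f s| < e.
Proof.
move=> fac e e0; have [r r0 rP] := fac e e0; exists r => // s t as_ st tb tsr.
have := rP 1%N (fun=> s) (fun=> t); rewrite !big_ord1; apply => //.
by move=> [|i] [|j].
Qed.

(* Sweep [a, b] from the left, charging [f] a slope [- eps] outside a small open set [U]
   containing the exceptional null set, and the variation of [f] inside [U]. *)
Lemma abs_cont_ae_nondecreasing (f : R -> R) (a b : R) : a <= b ->
  abs_cont f a b ->
  {ae mu, forall t, t \in `[a, b] -> exists2 d, is_derive t 1 f d & 0 <= d} ->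
  f a <= f b.
Proof.
move=> ab fac [N [mN N0 NP]].
have key e : 0 < e -> f a <= f b + e * (b - a) + e + e.
  move=> e0; have [de de0 deP] := fac e e0.
  have [U [oU NU UN]] : exists U : set R, [/\ open U , N `<=` U & (mu (U `\` N) < de%:E)%E].
    apply: lebesgue_regularity_outer => //.
    by rewrite [X in (X < _)%E](_ : _ = 0%E)// ltry.
  have mU : measurable U by exact: open_measurable.
  have muU : (mu U < de%:E)%E.
    rewrite (_ : mu U = mu (U `\` N))//.
    have mD : measurable (U `\` N) by exact: measurableD.
    have D0 : N `&` (U `\` N) = set0 by rewrite setIDA setIC -setIDA setDv setI0.
    have := @measureU _ _ _ mu _ _ mN mD D0.
    by rewrite (setDUK NU) => ->; rewrite [X in (X + _)%E](_ : _ = 0%E) ?add0e.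
  have mUa s : measurable (U `&` `[a, s]) by apply: measurableI => //; exact: measurable_itv.
  have leU s t : s <= t -> (mu (U `&` `[a, s]) <= mu (U `&` `[a, t]))%E.
    move=> st; apply: le_measure; rewrite ?inE; [exact: mUa|exact: mUa|].
    by apply: setIS; apply: subset_itvl; rewrite bnd_simp.
  (* [P s] records the sweep up to [s]: the intervals have their total length charged to [U], and
     the slack [eta] is what lets [P] pass to the supremum. *)
  pose P s := forall eta, 0 < eta -> exists k (u v : nat -> R),
    [/\ forall i, (i < k)%N -> a <= u i /\ u i <= v i /\ v i <= s,
        forall i j, (i < k)%N -> (j < k)%N -> i <> j -> v i <= u j \/ v j <= u i,
        ((\sum_(i < k) (v i - u i))%:E <= mu (U `&` `[a, s]))%E &
        f a <= f s + e * (s - a) + \sum_(i < k) `|f (v i) - f (u i)| + eta].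
  pose A := [set s | a <= s <= b /\ P s].
  have Aa : A a.
    split; first by rewrite lexx ab.
    move=> eta eta0; exists 0%N, (fun=> 0), (fun=> 0); split => //.
      by rewrite big_ord0.
    by rewrite big_ord0 subrr; lra.
  have Aub : ubound A b by move=> s [/andP[]].
  have hsA : has_sup A by split; [exists a|exists b].
  set s := sup A.
  have sb : s <= b by apply: sup_le_ub => //; exists a.
  have as_ : a <= s by exact: (sup_upper_bound hsA).
  have Ps : P s.
    move=> eta eta0; have eta2 : 0 < eta / 2 by rewrite divr_gt0.
    have [r r0 rP] := abs_cont_dist fac eta2.
    have [t [/andP[at_ tb] Pt] st] := sup_adherent r0 hsA.
    have ts : t <= s by apply: (sup_upper_bound hsA); split=> //; rewrite at_.
    have [k [u [v [uv dis le_mu fe]]]] := Pt _ eta2.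
    exists k, u, v; split => //.
    - by move=> i /uv[? [? ?]]; split => //; split => //; lra.
    - by apply: le_trans le_mu _; exact: leU.
    - have : `|f s - f t| < eta / 2 by apply: rP => //; rewrite /s; lra.
      rewrite ltr_norml => /andP[? _].
      have : e * (t - a) <= e * (s - a) by rewrite ler_pM2l// lerB.
      lra.
  have [sb'|sb'] := ltP s b; last first.
    have sE : s = b by apply/eqP; rewrite eq_le sb sb'.
    have [k [u [v [uv dis le_mu fe]]]] := Ps _ e0.
    rewrite sE in uv le_mu fe.
    have : \sum_(i < k) `|f (v i) - f (u i)| < e.
      apply: deP => //; rewrite -lte_fin; apply: le_lt_trans le_mu _.
      apply: le_lt_trans muU; apply: le_measure; rewrite ?inE; [exact: mUa|exact: mU|].
      exact: subIsetl.
    lra.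
  exfalso.
  suff [s' ss' [s'b Ps']] : exists2 s', s < s' & s' <= b /\ P s'.
    have : s' <= s by apply: (sup_upper_bound hsA); split=> //; rewrite s'b andbT; lra.
    lra.
  (* The sweep moves past [s]. Inside [U], the interval from [s] to [s'] joins the family; outside
     [U], hence outside [N], the derivative at [s] bounds the slope from below by [- e]. *)
  have [Us|nUs] := pselect (U s).
    have [r /= r0 rU] : exists2 r : R, 0 < r & ball s r `<=` U.
      by have /nbhs_ballP := open_nbhs_nbhs (conj oU Us).
    pose s' := Num.min (s + r / 2) b.
    have ss' : s < s' by rewrite lt_min sb' andbT; lra.
    have s'b : s' <= b by rewrite ge_min lexx orbT.
    have s'r : s' <= s + r / 2 by rewrite ge_min lexx.
    exists s' => //; split => // eta eta0.
    have [k [u [v [uv dis le_mu fe]]]] := Ps _ eta0.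
    exists k.+1, (fun i => if (i < k)%N then u i else s), (fun i => if (i < k)%N then v i else s').
    split.
    - move=> i; rewrite ltnS => ik; case: ifPn => [/uv|]; last by split; lra.
      by move=> [? [? ?]]; split => //; split => //; lra.
    - move=> i j; rewrite !ltnS => ik jk ij.
      case: ifPn => ik'; case: ifPn => jk'; first exact: dis.
      + by left; case: (uv i ik') => _ [].
      + by right; case: (uv j jk') => _ [].
      + by exfalso; apply: ij; apply/eqP; rewrite eqn_leq; move: ik' jk'; rewrite -!leqNgt => ? ?;
          rewrite (leq_trans ik)// (leq_trans jk).
    - rewrite big_ord_recr /= ltnn; under eq_bigr do rewrite ltn_ord.
      rewrite EFinD; apply: (@le_trans _ _ (mu (U `&` `[a, s]) + mu `]s, s'])%E).
        apply: leeD => //.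
        by rewrite lebesgue_measure_itv /= lte_fin ss' EFinB.
      have D0 : U `&` `[a, s] `&` `]s, s'] = set0.
        rewrite -subset0 => x [[_ /=]]; rewrite !in_itv/= => /andP[_ ?] /andP[? _]; lra.
      rewrite -(@measureU _ _ _ mu _ _ (mUa s) (measurable_itv _) D0).
      apply: le_measure; rewrite ?inE; [|exact: mUa|].
        by apply: measurableU; [exact: mUa|exact: measurable_itv].
      move=> x [[Ux /=]|/=]; rewrite in_itv/= => /andP[x1 x2].
        by split => //=; rewrite in_itv/=; apply/andP; split; lra.
      split; last by rewrite /= in_itv/=; apply/andP; split; lra.
      apply: rU; rewrite -ball_normE /= ltr_norml; apply/andP; split; lra.
    - rewrite big_ord_recr /= ltnn; under eq_bigr do rewrite ltn_ord.
      have : f s - f s' <= `|f s' - f s| by rewrite distrC ler_norm.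
      have : e * (s - a) <= e * (s' - a) by rewrite ler_pM2l// lerB// ltW.
      lra.
  have [d fd d0] : exists2 d, is_derive s 1 f d & 0 <= d.
    have nNs : ~ N s by move=> /NU.
    have /contrapT := contra_not (@NP s) nNs; apply.
    by rewrite in_itv /= as_ sb.
  have [r r0 rP] := is_derive_eps fd e0.
  pose s' := Num.min (s + r / 2) b.
  have ss' : s < s' by rewrite lt_min sb' andbT; lra.
  have s'b : s' <= b by rewrite ge_min lexx orbT.
  have s'r : s' <= s + r / 2 by rewrite ge_min lexx.
  exists s' => //; split => // eta eta0.
  have [k [u [v [uv dis le_mu fe]]]] := Ps _ eta0.
  exists k, u, v; split => //.
  - by move=> i /uv[? [? ?]]; split => //; split => //; lra.
  - by apply: le_trans le_mu _; apply: leU; exact: ltW.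
  - have /rP : `|s' - s| < r by rewrite ger0_norm; lra.
    rewrite [s + _]addrC subrK [`|s' - s|]ger0_norm; last by lra.
    rewrite ler_norml [(s' - s) *: d]/GRing.scale /= => /andP[+ _].
    have : 0 <= (s' - s) * d by rewrite mulr_ge0// subr_ge0 ltW.
    have -> : e * (s' - a) = e * (s - a) + e * (s' - s) by ring.
    lra.
apply/ler_addgt0Pr => e e0; have c0 : 0 < b - a + 2 by lra.
have := key (e / (b - a + 2)) (divr_gt0 e0 c0).
have : e / (b - a + 2) * (b - a + 2) = e by rewrite divfK// gt_eqF.
lra.
Qed.

End AbsCont.

(** * Differential calculus *)

Lemma is_derive_mull {R : realType} (k t : R) : is_derive t 1 (fun s : R => k * s) k.
Proof. by have := is_deriveZ k (is_derive_id t (1 : R)); rewrite [_ *: 1]mulr1. Qed.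

Lemma is_derive_expR_mull {R : realType} (k t : R) :
  is_derive t 1 (fun s : R => expR (k * s)) (k * expR (k * t)).
Proof.
apply: is_derive_eq (is_derive1_comp (is_derive_expR _) (is_derive_mull k t)) _.
exact: mulrC.
Qed.

Section Calculus.
Context {R : realType} {n : nat}.
Local Notation V := 'rV[R]_n.
Implicit Types (f g : R -> V) (t : R).

Lemma is_derive_coord f t (d : V) i :
  is_derive t 1 f d -> is_derive t 1 (fun s => f s ord0 i) (d ord0 i).
Proof.
move=> [fd <-]; apply: DeriveDef; first exact: (iffLR (derivable_mxP _ _ _) fd).
by rewrite (derive_mx fd) mxE.
Qed.

Lemma is_derive_row f t (d : V) :
  (forall i, is_derive t 1 (fun s => f s ord0 i) (d ord0 i)) -> is_derive t 1 f d.
Proof.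
move=> fd.
have df : derivable f t 1.
  by apply/derivable_mxP => j i; rewrite ord1; case: (fd i).
apply: DeriveDef => //; rewrite (derive_mx df); apply/rowP => i.
by rewrite mxE; case: (fd i).
Qed.

Lemma is_derive_edot f g t (df dg : V) :
  is_derive t 1 f df -> is_derive t 1 g dg ->
  is_derive t 1 (fun s => edot (f s) (g s)) (edot df (g t) + edot (f t) dg).
Proof.
move=> fd gd.
rewrite (_ : (fun s => _) = \sum_(i < n) ((fun s => f s ord0 i) * (fun s => g s ord0 i))); last first.
  by apply/funext => s; rewrite /edot fct_sumE.
apply: is_derive_eq.
  by apply: is_derive_sum => i; apply: is_deriveM; exact: is_derive_coord.
rewrite /edot -big_split; apply: eq_bigr => i _ /=.
by rewrite addrC [g t ord0 i *: _]mulrC.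
Qed.

Lemma is_derive_continuous f t (d : V) : is_derive t 1 f d -> {for t, continuous f}.
Proof. by move=> [fd _]; apply: differentiable_continuous; apply/derivable1_diffP. Qed.

Lemma is_derive_le (f df : R -> R) (a b : R) : a <= b ->
  (forall t, a <= t <= b -> is_derive t 1 f (df t)) ->
  (forall t, a <= t <= b -> 0 <= df t) -> f a <= f b.
Proof.
move=> ab fd df0.
have [t|//|c cab fE] := @MVT_segment R f df a b ab.
- by rewrite in_itv/= => /andP[? ?]; apply: fd; apply/andP; split; exact: ltW.
- apply: derivable_within_continuous => t; rewrite in_itv/= => tab.
  by case: (fd t tab).
- move: cab; rewrite in_itv/= => /df0 c0.
  by rewrite -subr_ge0 fE mulr_ge0// subr_ge0.
Qed.

(** Mean value inequality: pairing [u] with its own increment [w] makes the scalar function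
    [enorm w * v t - edot w (u t)] nondecreasing. *)
Lemma enorm_increment_le (u du : R -> V) (v dv : R -> R) (a b : R) : a <= b ->
  (forall t, a <= t <= b -> is_derive t 1 u (du t)) ->
  (forall t, a <= t <= b -> is_derive t 1 v (dv t)) ->
  (forall t, a <= t <= b -> enorm (du t) <= dv t) ->
  enorm (u b - u a) <= v b - v a.
Proof.
move=> ab ud vd le_dv; set w := u b - u a.
have [->|w0] := eqVneq w 0.
  rewrite enorm0 subr_ge0; apply: is_derive_le ab vd _ => t /le_dv.
  exact: le_trans (enorm_ge0 _).
have : enorm w * v a - edot w (u a) <= enorm w * v b - edot w (u b).
  apply: (@is_derive_le (fun t => enorm w * v t - edot w (u t))
    (fun t => enorm w * dv t - edot w (du t)) a b ab) => t tab.
    apply: is_deriveB.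
      by have := is_deriveZ (enorm w) (vd t tab).
    have := @is_derive_edot (cst w) u t 0 (du t) (is_derive_cst _ _ _) (ud t tab).
    by rewrite edot0l add0r.
  rewrite subr_ge0 (le_trans (edot_le _ _))// ler_wpM2l ?enorm_ge0//.
  exact: le_dv.
have := enorm_gt0 w0; move=> w_gt0 h.
rewrite -(ler_pM2l w_gt0) -expr2 sqr_enorm mulrBr.
have ww : edot w w = edot w (u b) - edot w (u a).
  by rewrite {2}/w edotDr edotNr.
rewrite ww; lra.
Qed.

Lemma antiderivative_real (h : R -> R) : continuous h ->
  exists G : R -> R, G 0 = 0 /\ forall t : R, 0 <= t -> is_derive t 1 G (h t).
Proof.
move=> ch.
(* Integrating from [-1] makes [0] an interior point, so the derivative at [0] is two-sided. *)
pose F (x : R) := (\int[@lebesgue_measure R]_(t in `[(-1)%R, x]) (h t))%R.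
exists (fun x => F x - F 0); split; first by rewrite subrr.
move=> t t0.
have [] := @continuous_FTC1_closed R h (-1) t (t + 1).
- by rewrite ltrDl.
- apply: continuous_compact_integrable; first exact: segment_compact.
  exact: continuous_subspaceT.
- by rewrite (lt_le_trans _ t0)// ltrN10.
- exact: ch.
move=> dF F'; rewrite -[h t]subr0; apply: is_deriveB.
by rewrite -F'; rewrite derive1E; exact: derivableP dF.
Qed.

Lemma antiderivative f : continuous f ->
  exists G : R -> V, G 0 = 0 /\ forall t : R, 0 <= t -> is_derive t 1 G (f t).
Proof.
move=> cf.
have /choice[G GP] : forall i : 'I_n, exists G : R -> R, G 0 = 0 /\
    forall t : R, 0 <= t -> is_derive t 1 G (f t ord0 i).
  move=> i; apply: antiderivative_real => t.
  exact: (cvg_comp _ _ (cf t) (@coord_continuous _ _ _ ord0 i (f t))).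
exists (fun t => \row_i G i t); split.
  by apply/rowP => i; rewrite !mxE; case: (GP i).
move=> t t0; apply: is_derive_row => i.
rewrite (_ : (fun s => _) = G i); first by case: (GP i) => _; exact.
by apply/funext => s; rewrite mxE.
Qed.

(** Every [u i - c / 2 ^+ i] lies below every [u k + c / 2 ^+ k], so the supremum of the former is
    within [c / 2 ^+ k] of [u k]: the rate comes with the limit. *)
Lemma geometric_limit (u : nat -> R) (c : R) :
  (forall k m, (k <= m)%N -> `|u m - u k| <= c / 2 ^+ k) ->
  exists l, forall k, `|l - u k| <= c / 2 ^+ k.
Proof.
move=> uc.
have ub k : ubound [set u i - c / 2 ^+ i | i in [set: nat]] (u k + c / 2 ^+ k).
  move=> _ [i _ <-]; have [ik|/ltnW ki] := leqP i k.
    have := uc _ _ ik; have := le_trans (normr_ge0 _) (uc k k (leqnn _)).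
    rewrite ler_norml => ? /andP[? _]; lra.
  have := uc _ _ ki; have := le_trans (normr_ge0 _) (uc i i (leqnn _)).
  rewrite ler_norml => ? /andP[_ ?]; lra.
have ne : [set u i - c / 2 ^+ i | i in [set: nat]] !=set0.
  by exists (u 0%N - c / 2 ^+ 0); exists 0%N.
exists (sup [set u i - c / 2 ^+ i | i in [set: nat]]) => k.
have h1 := sup_le_ub ne (ub k).
have h2 : u k - c / 2 ^+ k <= sup [set u i - c / 2 ^+ i | i in [set: nat]].
  by apply: sup_upper_bound; [split=> //; exists (u 0%N + c / 2 ^+ 0)|exists k].
rewrite ler_norml; apply/andP; split; lra.
Qed.

Lemma geometric_small (c e : R) : 0 < e -> exists k, c / 2 ^+ k < e.
Proof.
move=> e0; exists (Num.truncn `|c / e|).+1.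
rewrite ltr_pdivrMr ?exprn_gt0// mulrC -ltr_pdivrMr//.
apply: le_lt_trans (ler_norm _) _; have /andP[_] := truncn_itv (normr_ge0 (c / e)).
move=> /lt_le_trans; apply; rewrite -natrX ler_nat.
exact: ltnW (ltn_expl _ _).
Qed.

End Calculus.

(** * Picard iteration *)

(** Retraction of the line onto [[a, b]]; composing an arc with it extends the arc by its end
    values. *)
Definition clamp {R : realType} (a b s : R) : R := Num.max a (Num.min s b).

Lemma dist_clamp {R : realType} (a b s t : R) : `|clamp a b s - clamp a b t| <= `|s - t|.
Proof.
rewrite /clamp ler_norml /Order.max /Order.min.
have h1 := ler_norm (s - t); have h2 := ler_norm (t - s); rewrite distrC in h2.
have h0 := normr_ge0 (s - t).
apply/andP.
by case: (ltP s b) => ?; case: (ltP t b) => ?; case: ltP => ?; case: ltP => ?; split; lra.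
Qed.

Lemma nonexpansive_continuous {R : realType} (f : R -> R) :
  (forall s t, `|f s - f t| <= `|s - t|) -> continuous f.
Proof.
move=> fL t; apply/cvgrPdist_lt => e e0.
have /cvgrPdist_lt/(_ e e0) : x @[x --> t] --> t by exact: cvg_id.
by apply: filterS => s; exact: le_lt_trans.
Qed.

Section Picard.
Context {R : realType} {n : nat}.
Local Notation V := 'rV[R]_n.
Variables (g : R -> V -> V) (L M : R) (y0 : V).
Hypothesis L0 : 0 < L.
Hypothesis gc : forall y, continuous (g ^~ y).
Hypothesis gL : forall s y z, enorm (g s y - g s z) <= L * enorm (y - z).
Hypothesis gM : forall s, enorm (g s y0) <= M.

Lemma continuous_along (u : R -> V) (t : R) : {for t, continuous u} ->
  {for t, continuous (fun s => g s (u s))}.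
Proof.
move=> cu; apply/continuous_enormP => e e0.
have e2 : 0 < e / 2 by rewrite divr_gt0.
have c1 := iffLR (continuous_enormP (g ^~ (u t)) t) (@gc (u t) t) _ e2.
have c2 := iffLR (continuous_enormP u t) cu _ (divr_gt0 e2 L0).
apply: filterS2 c1 c2 => s h1 h2.
have := enorm_dist (g s (u s)) (g s (u t)) (g t (u t)).
have := gL s (u s) (u t).
have : L * enorm (u s - u t) < L * (e / 2 / L) by rewrite ltr_pM2l.
have -> : L * (e / 2 / L) = e / 2 by rewrite mulrC divfK// gt_eqF.
lra.
Qed.

Let half_cont (u : R -> V) := forall t : R, 0 <= t -> {for t, continuous u}.

(** The Picard operator. The antiderivative is chosen by [xget] with default 0, so its value is
    meaningful only when an antiderivative exists, as it does for [u] continuous at nonnegative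
    times. *)
Let step (u : R -> V) : R -> V := fun s => y0 +
  xget (fun=> 0) [set G : R -> V | G 0 = 0 /\
    forall t : R, 0 <= t -> is_derive t 1 G (g t (u t))] s.

Let stepP u : half_cont u -> step u 0 = y0 /\
  forall t : R, 0 <= t -> is_derive t 1 (step u) (g t (u t)).
Proof.
move=> cu; rewrite /step; case: xgetP => [G _ [G0 dG]|nG].
  split; first by rewrite G0 addr0.
  move=> t t0; rewrite -[g t (u t)]add0r; apply: is_deriveD; exact: dG.
exfalso.
(* Replacing [u] at negative times by [u 0] makes the integrand continuous on the whole line without
   changing it on the half-line. *)
have cmax : continuous (fun s : R => Num.max s 0).
  apply: nonexpansive_continuous => s t; rewrite /Order.max.
  have := ler_norm (s - t); have := ler_norm (t - s); rewrite distrC ler_norml => ? ?.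
  by case: ltP => ?; case: ltP => ?; apply/andP; split; lra.
have cum : continuous (fun s : R => u (Num.max s 0)).
  move=> t; apply: (cvg_comp _ _ (cmax t)); apply: cu.
  by rewrite le_max lexx orbT.
have [G [G0 dG]] := antiderivative (fun t => continuous_along (cum t)).
apply: (nG G); split=> // t t0.
by have := dG t t0; rewrite max_l.
Qed.

Let Y k := iter k step (fun=> y0).

Let Y_cont k : half_cont (Y k).
Proof.
elim: k => [|k ih] t t0; first exact: cst_continuous.
exact: is_derive_continuous ((stepP ih).2 t t0).
Qed.

Let Y0 k : Y k 0 = y0.
Proof. by case: k => [//|k]; exact: (stepP (@Y_cont k)).1. Qed.

Let dY k (t : R) : 0 <= t -> is_derive t 1 (Y k.+1) (g t (Y k t)).
Proof. exact: (stepP (@Y_cont k)).2. Qed.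

Let err (c : R) (k : nat) (s : R) : R := c / 2 ^+ k * expR (2 * L * s).

Let derr (c : R) k (s : R) : is_derive s 1 (err c k) (2 * L * err c k s).
Proof.
have h := is_deriveZ (c / 2 ^+ k) (is_derive_expR_mull (2 * L) s).
apply: (@is_derive_eq _ _ _ (err c k) _ _ _ _ h).
by rewrite /err /GRing.scale /=; ring.
Qed.

Let errS (c : R) k (s : R) : 2 * err c k.+1 s = err c k s.
Proof. by rewrite /err exprS invfM; field. Qed.

(* The weight [expR (2 L s)] makes the Picard operator a [1/2]-contraction. *)
Let contraction (c : R) k (u v w z : R -> V) : 0 <= c ->
  (forall t : R, 0 <= t -> is_derive t 1 w (g t (u t))) ->
  (forall t : R, 0 <= t -> is_derive t 1 z (g t (v t))) -> w 0 = z 0 ->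
  (forall t : R, 0 <= t -> enorm (u t - v t) <= err c k t) ->
  forall t : R, 0 <= t -> enorm (w t - z t) <= err c k.+1 t.
Proof.
move=> c0 dw dz wz0 uv t t0.
have := @enorm_increment_le _ _ (fun s => w s - z s) (fun s => g s (u s) - g s (v s))
  (err c k.+1) (fun s => 2 * L * err c k.+1 s) 0 t t0.
rewrite wz0 subrr subr0 => h.
have e0 : 0 <= err c k.+1 0 by rewrite mulr_ge0 ?expR_ge0// divr_ge0// exprn_ge0.
apply: le_trans (h _ _ _) _.
- by move=> s /andP[s0 _]; apply: is_deriveB; [exact: dw|exact: dz].
- by move=> s _; exact: derr.
- move=> s /andP[s0 _]; apply: le_trans (gL _ _ _) _.
  by rewrite mulrAC errS [leRHS]mulrC ler_pM2l// uv.
- lra.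
Qed.

Lemma picard_lindelof : exists y : R -> V, y 0 = y0 /\
  forall t : R, 0 <= t -> is_derive t 1 y (g t (y t)).
Proof.
have M0 : 0 <= M := le_trans (enorm_ge0 _) (gM 0).
(* The first increment has velocity at most [M], while [err c 0] grows at rate at least
   [2 L c = 2 M]. *)
pose c := M / L.
have c0 : 0 <= c by rewrite divr_ge0// ltW.
have errc0 k (s : R) : 0 <= err c k s by rewrite mulr_ge0 ?expR_ge0// divr_ge0// exprn_ge0.
have inc k (t : R) : 0 <= t -> enorm (Y k.+1 t - Y k t) <= err c k t.
  elim: k t => [|k ih] t t0; last first.
    apply: (contraction c0 (@dY k.+1) (@dY k) _ ih t0); by rewrite !Y0.
  have := @enorm_increment_le _ _ (Y 1) (fun s => g s y0)
    (err c 0) (fun s => 2 * L * err c 0 s) 0 t t0.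
  rewrite Y0 => h; apply: le_trans (h _ _ _) _.
  - by move=> s /andP[s0 _]; exact: (dY 0).
  - by move=> s _; exact: derr.
  - move=> s /andP[s0 _]; apply: le_trans (gM s) _.
    rewrite /err expr0 divr1 mulrA (_ : 2 * L * c = 2 * M); last first.
      by rewrite /c -mulrA [L * _]mulrC divfK// gt_eqF.
    have : 1 <= expR (2 * L * s) by rewrite -expR0 ler_expR !mulr_ge0// ltW.
    by move=> h1; have := ler_wpM2l M0 h1; lra.
  - have := errc0 0%N 0; lra.
have cau k m (t : R) : 0 <= t -> (k <= m)%N ->
    enorm (Y m t - Y k t) <= 2 * err c k t - 2 * err c m t.
  move=> t0 /subnK <-; elim: (m - k)%N => [|j ih]; first by rewrite subrr enorm0 subrr.
  have := enorm_dist (Y (j + k).+1 t) (Y (j + k)%N t) (Y k t).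
  by have := inc (j + k)%N t t0; have := errS c (j + k)%N t; rewrite addSn; lra.
(* The limit is taken coordinatewise: [2 c] sums the geometric tail, and [n.+1] pays for the return
   to the Euclidean norm. *)
pose C := n.+1%:R * (2 * c).
have C0 : 0 <= C by apply: mulr_ge0; [exact: ler0n|apply: mulr_ge0; [exact: ler0n|]].
have /choice[y yP] : forall t, exists l : V, 0 <= t -> forall k, enorm (l - Y k t) <= err C k t.
  move=> t; have [t0|t0] := leP 0 t; last by exists 0.
  have /choice[l lP] : forall i : 'I_n, exists l : R, forall k,
      `|l - Y k t ord0 i| <= 2 * c * expR (2 * L * t) / 2 ^+ k.
    move=> i; apply: geometric_limit => k m km.
    have := coord_le_enorm (Y m t - Y k t) i; rewrite !mxE => /le_trans; apply.
    apply: le_trans (cau _ _ _ t0 km) _.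
    have -> : 2 * c * expR (2 * L * t) / 2 ^+ k = 2 * err c k t by rewrite /err; ring.
    have := errc0 m t; lra.
  exists (\row_i l i) => _ k.
  have -> : err C k t = n.+1%:R * (2 * err c k t) by rewrite /err /C; ring.
  apply: le_trans (enorm_le_norm _) _; rewrite ler_pM2l//.
  rewrite /Num.Def.normr/= mx_normrE; apply: bigmax_le; first exact: mulr_ge0.
  move=> [j i] _ /=; rewrite ord1 !mxE; apply: le_trans (lP i k) _.
  by rewrite /err le_eqVlt; apply/orP; left; apply/eqP; ring.
have cy : half_cont (fun t : R => y (Num.max t 0)).
  move=> t t0; apply/continuous_enormP => e e0.
  have e3 : 0 < e / 3 by rewrite divr_gt0.
  have [k kP] := geometric_small (C * expR (2 * L * (t + 1))) e3.
  have near1 := iffLR (continuous_enormP (Y k) t) (@Y_cont k t t0) _ e3.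
  have small (s : R) : 0 <= s -> s <= t + 1 -> enorm (y s - Y k s) < e / 3.
    move=> s0 st; apply: le_lt_trans (yP s s0 k) _; apply: le_lt_trans kP.
    rewrite /err mulrAC ler_wpM2r ?invr_ge0 ?exprn_ge0//.
    by rewrite ler_wpM2l// ler_expR ler_pM2l// mulr_gt0.
  have [r /= r0 rP] := iffLR (nbhs_ballP _ _) near1.
  apply/nbhs_ballP; exists (Num.min r 1); first by rewrite /= lt_min r0 ltr01.
  move=> s; rewrite -ball_normE /= lt_min => /andP[sr s1].
  have s's : `|t - Num.max s 0| <= `|t - s|.
    rewrite /Order.max; case: ltP => // s0; rewrite subr0 (ger0_norm t0).
    by have := ler_norm (t - s); lra.
  rewrite (max_l t0).
  have : 0 <= Num.max s 0 by rewrite le_max lexx orbT.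
  move: (Num.max s 0) s's => s' s's s'0.
  have st1 : s' <= t + 1.
    have := le_lt_trans s's s1; have := ler_norm (s' - t); rewrite distrC; lra.
  have := rP s'; rewrite -ball_normE /= => /(_ (le_lt_trans s's sr)) h1.
  have := small s' s'0 st1; have := small t t0 _; rewrite enormB => /(_ _) h2 h3.
  have := enorm_dist (y s') (Y k s') (y t); have := enorm_dist (Y k s') (Y k t) (y t).
  have := h2 ltac:(lra); lra.
(* One more application of the operator to the limit gives a differentiable [z]. By contraction [z]
   and [y] are both within [err C k.+1] of the same iterate for every [k], so they agree. *)
have [z0 dz] := stepP cy; set z := step _ in z0 dz.
have zy (t : R) : 0 <= t -> z t = y t.
  move=> t0; apply/eqP; rewrite -subr_eq0; apply/eqP; apply: enorm_eq0.
  apply/eqP; rewrite eq_le enorm_ge0 andbT; apply/ler_addgt0Pr => e e0; rewrite add0r.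
  have [k kP] := geometric_small (C * expR (2 * L * t)) e0.
  apply: le_trans (ltW kP).
  have -> : C * expR (2 * L * t) / 2 ^+ k = err C k t by rewrite /err; ring.
  have h1 : enorm (z t - Y k.+1 t) <= err C k.+1 t.
    apply: (contraction C0 dz (@dY k) _ _ t0); first by rewrite z0 Y0.
    by move=> s s0; rewrite max_l//; exact: yP.
  have := enorm_dist (z t) (Y k.+1 t) (y t).
  rewrite [enorm (Y _ _ - _)]enormB; have := yP t t0 k.+1; have := errS C k t.
  lra.
exists z; split => // t t0.
by have := dz t t0; rewrite max_l// -zy.
Qed.

End Picard.

(** * Semiconvexity and the Hamiltonian *)

Section Clarke.
Context {R : realType} {n : nat}.
Local Notation V := 'rV[R]_n.

(** A maximizer of [f] minus its chord is the midpoint of an endpoint, where the difference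
    vanishes, and another point of [[0, 1]]; so the maximum is at most half itself. *)
Lemma midpoint_convex_le (f : R -> R) : continuous f ->
  (forall a b, f ((a + b) / 2) <= (f a + f b) / 2) ->
  forall t, 0 <= t <= 1 -> f t <= (1 - t) * f 0 + t * f 1.
Proof.
move=> cf fmid t t01.
pose h s := f s - (f 0 + s * (f 1 - f 0)).
have ch : continuous h.
  move=> s; apply: cvgB; first exact: cf.
  by apply: cvgD; [exact: cvg_cst|apply: cvgM; [exact: cvg_id|exact: cvg_cst]].
have hmid a b : h ((a + b) / 2) <= (h a + h b) / 2.
  by have := fmid a b; rewrite /h; lra.
have h0 : h 0 = 0 by rewrite /h; ring.
have h1 : h 1 = 0 by rewrite /h; ring.
have [c c01 cmax] := @EVT_max R h 0 1 ler01 (continuous_subspaceT ch).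
suff hc : h c <= 0.
  have := le_trans (cmax t _) hc; rewrite in_itv /= => /(_ t01); rewrite /h; lra.
move: c01; rewrite in_itv/= => /andP[c0 c1].
have [c2|c2] := leP c (1 / 2).
  have := hmid 0 (2 * c); rewrite (_ : (0 + 2 * c) / 2 = c); last by field.
  have /cmax : 2 * c \in `[0, 1] by rewrite in_itv/=; lra.
  lra.
have := hmid 1 (2 * c - 1); rewrite (_ : (1 + (2 * c - 1)) / 2 = c); last by field.
have /cmax : 2 * c - 1 \in `[0, 1] by rewrite in_itv/=; lra.
lra.
Qed.

Lemma semiconvex_continuous (g : V -> R) c : semiconvex g c -> continuous g.
Proof.
move=> [cg _] y; apply/continuous_realP => e e0.
have [d d0 dP] := iffLR (continuous_realP _ _) (cg y) e e0.
by exists d => // z /dP; rewrite -opprB opprK addrC normrN distrC.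
Qed.

(** Along the line, [g] plus [c t^2 |v|^2] is midpoint convex: the added square gains exactly
    [c (a - b)^2 |v|^2 / 4], the defect that semiconvexity allows. *)
Lemma semiconvex_chord (g : V -> R) c (y v : V) (t : R) : semiconvex g c ->
  0 <= t <= 1 ->
  g (y + t *: v) + c * t ^+ 2 * enorm v ^+ 2
    <= (1 - t) * g y + t * (g (y + v) + c * enorm v ^+ 2).
Proof.
move=> gc t01; have cg := semiconvex_continuous gc; case: gc => _ gmid.
have := @midpoint_convex_le (fun t => g (y + t *: v) + c * t ^+ 2 * enorm v ^+ 2) _ _ t t01.
rewrite !scale0r scale1r addr0 expr0n expr1n /= => h.
apply: le_trans (h _ _) _; last lra.
- move=> s; apply: cvgD.
    apply: (cvg_comp (fun s : R => y + s *: v)); last exact: cg.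
    by apply: cvgD; [exact: cvg_cst|apply: cvgZr_tmp; exact: cvg_id].
  apply: cvgM; last exact: cvg_cst.
  by apply: cvgM; [exact: cvg_cst|exact: exprn_continuous].
- move=> a b; have := gmid (y + a *: v) (y + b *: v).
  rewrite (_ : 2^-1 *: _ = y + ((a + b) / 2) *: v); last first.
    by apply/rowP => i; rewrite !mxE; field.
  rewrite (_ : y + a *: v - _ = (a - b) *: v); last first.
    by rewrite opprD addrACA subrr add0r scalerBl.
  rewrite enormZ exprMn real_normK ?num_real//.
  have -> : c * ((a + b) / 2) ^+ 2 * enorm v ^+ 2 = (c * a ^+ 2 * enorm v ^+ 2 +
     c * b ^+ 2 * enorm v ^+ 2) / 2 - c / 4 * ((a - b) ^+ 2 * enorm v ^+ 2) by field.
  lra.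
Qed.

(** The chord inequality bounds the quotients [(g (z + t *: v) - g z) / t] uniformly in [t <= 1], so
    continuity of [g] at [x] and [y] is enough to control the Clarke derivative. *)
Lemma clarke_grad_semiconvex (g : V -> R) c (x zeta y : V) : 0 <= c ->
  semiconvex g c -> clarke_grad g x zeta ->
  edot zeta (y - x) <= g y - g x + c * enorm (y - x) ^+ 2.
Proof.
move=> c0 gc /(_ (y - x)); set v := y - x => zv.
have yE : y = x + v by rewrite /v addrC subrK.
have cg := semiconvex_continuous gc.
apply/ler_addgt0Pr => e e0; have e2 : 0 < e / 2 by rewrite divr_gt0.
have [r1 r10 h1] := iffLR (continuous_realP _ _) (cg x) _ e2.
have [r2 r20 h2] := iffLR (continuous_realP _ _) (cg y) _ e2.
pose r := Num.min (Num.min r1 r2) 1.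
have r0 : 0 < r by rewrite !lt_min r10 r20 ltr01.
rewrite -lee_fin; apply: le_trans zv _; apply: ge_ereal_inf.
eexists; first by exists r; [exact: r0|reflexivity].
apply: ge_ereal_sup => _ [z [t [zx /andP[t0 tr] ->]]]; rewrite lee_fin.
move: zx tr; rewrite !lt_min => /andP[/andP[z1 z2] _] /andP[_ t1].
have := @semiconvex_chord g c z v t gc; rewrite (ltW t0) (ltW t1) => /(_ isT) hc.
have := h1 z z1; have := h2 (z + v); rewrite {1}yE opprD addrACA subrr addr0 => /(_ z2).
rewrite !ltr_norml => /andP[a1 a2] /andP[a3 a4].
rewrite ler_pdivrMr//.
have : 0 <= c * t ^+ 2 * enorm v ^+ 2 
  by apply: mulr_ge0; [apply: mulr_ge0 => //; exact: sqr_ge0|exact: sqr_ge0].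
have h : t * (g (z + v) - g z) <= t * (g y - g x + e) by rewrite ler_pM2l//; lra.
lra.
Qed.

End Clarke.

(** * The Hamiltonian as a support function, and its maximizers *)

Section Hamiltonian.
Context {R : realType} {n : nat}.
Local Notation V := 'rV[R]_n.
Variables (F : V -> set V) (K : R).
Hypothesis F0 : forall y, F y !=set0.
Hypothesis Fc : forall y, compact (F y).
Hypothesis K0 : 0 < K.
Hypothesis FK : lipschitz_multi F K.

Lemma Ham_attained y p : exists2 v, F y v & forall w, F y w -> edot p w <= edot p v.
Proof.
have [|v vF vmax] := compact_EVT_max (F0 y) (@Fc y) (f := edot p).
  apply: continuous_subspaceT => v.
  apply: (@continuous_edot _ _ _ (cst p) id v); [exact: cst_continuous|exact: cvg_id].
by exists v => [|w wF]; [rewrite inE in vF|apply: vmax; rewrite inE].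
Qed.

Lemma Ham_max y p v : F y v -> (forall w, F y w -> edot p w <= edot p v) ->
  Ham F y p = edot p v.
Proof.
move=> vF vmax; apply/eqP; rewrite eq_le; apply/andP; split.
  by apply: sup_le_ub; [exists (edot p v); exists v|move=> _ [w wF <-]; exact: vmax].
apply: sup_upper_bound; last by exists v.
split; first by exists (edot p v); exists v.
by exists (edot p v) => _ [w wF <-]; exact: vmax.
Qed.

Lemma Ham_ge y p v : F y v -> edot p v <= Ham F y p.
Proof. by have [w wF wmax] := Ham_attained y p; rewrite (Ham_max wF wmax); exact: wmax. Qed.

Lemma HamE y p : exists2 v, F y v & Ham F y p = edot p v.
Proof. by have [v vF vmax] := Ham_attained y p; exists v => //; exact: Ham_max. Qed.

Lemma HamZ y (l : R) p : 0 <= l -> Ham F y (l *: p) = l * Ham F y p.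
Proof.
move=> l0; have [v vF vmax] := Ham_attained y p.
rewrite (Ham_max vF vmax) -edotZl; apply: Ham_max => // w /vmax.
by rewrite !edotZl; exact: ler_wpM2l.
Qed.

Lemma Ham_lipschitz y z p : Ham F y p <= Ham F z p + K * enorm p * enorm (y - z).
Proof.
have [v vF ->] := HamE y p; have [w wF vw] := FK z vF.
have := Ham_ge p wF; have := edot_le p (v - w); rewrite edotDr edotNr.
have := ler_wpM2l (enorm_ge0 p) vw; rewrite (enormB z y); lra.
Qed.

Lemma F_bounded y : exists2 M : R, 0 <= M & forall v, F y v -> enorm v <= M.
Proof.
have [|v vF vmax] := compact_EVT_max (F0 y) (@Fc y) (f := @enorm R n).
  by apply: continuous_subspaceT; exact: continuous_enorm.
by exists (enorm v) => [|w wF]; [exact: enorm_ge0|apply: vmax; rewrite inE].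
Qed.

Lemma F_growth y M z v : (forall w, F y w -> enorm w <= M) -> F z v ->
  enorm v <= M + K * enorm (z - y).
Proof.
move=> FM /(FK y)[w /FM wM]; have := enormD (v - w) w; rewrite subrK (enormB y z); lra.
Qed.

(* Envelope argument: if [v] is a maximizer at [p], then [h |-> edot (p + h) v] supports
   [h |-> Ham F y (p + h)] from below and touches it at [h = 0]. *)
Lemma grad_at_argmax y p d : grad_at (Ham F y) p d ->
  F y d /\ edot p d = Ham F y p.
Proof.
move=> gd; have [v vF vE] := HamE y p.
suff <- : v = d by [].
apply/eqP; rewrite -subr_eq0; apply/eqP; set w := v - d.
have [//|w0] := eqVneq w 0; have wp := enorm_gt0 w0; exfalso.
have [r r0 rP] := gd (enorm w / 2) (divr_gt0 wp (ltr0Sn _ _)).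
pose s := r / 2 / enorm w.
have s0 : 0 < s by rewrite !divr_gt0.
have sw : enorm (s *: w) = r / 2.
  by rewrite enormZ gtr0_norm// /s divfK// gt_eqF.
have : enorm (s *: w) < r by rewrite sw; lra.
move=> /rP; rewrite sw => /ler_normlW.
have := Ham_ge (p + s *: w) vF; rewrite edotDl vE edotZl edotZr.
have vd : s * edot w v - s * edot d w = s * enorm w * enorm w.
  by rewrite (edotC d) -mulrBr -mulrA -expr2 sqr_enorm {3}/w edotDr edotNr.
have : s * enorm w = r / 2 by rewrite /s divfK// gt_eqF.
move=> sw'; rewrite sw' in vd.
have : 0 < r / 2 * enorm w by rewrite mulr_gt0// divr_gt0.
lra.
Qed.

(** The envelope argument made quantitative: a maximizer [v] at [q] is maximal at [p] up to
    [2 M |q - p|], and differentiability at [p], tested in the direction [v - d] at distance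
    [r / 2], forces [v] close to [d]. It yields continuity in time of the flow's velocity. *)
Lemma argmax_continuous y p d e : grad_at (Ham F y) p d -> 0 < e ->
  exists2 r : R, 0 < r & forall q v, enorm (q - p) < r ->
    F y v -> edot q v = Ham F y q -> enorm (v - d) <= e.
Proof.
move=> gd e0; have [dF dE] := grad_at_argmax gd.
have [M M0 FM] := F_bounded y.
have [r r0 rP] := gd (e / 2) (divr_gt0 e0 (ltr0Sn _ _)).
have M4 : 0 < 8 * (M + 1) by lra.
(* With this radius [2 M |q - p| < e r / 4]; together with the gradient error [e r / 4] this makes
   [(r / 2) e]. *)
exists (e * r / (8 * (M + 1))); first by rewrite divr_gt0// mulr_gt0.
move=> q v; rewrite ltr_pdivlMr// => qp vF vE; set w := v - d.
have [->|w0] := eqVneq w 0; first by rewrite enorm0 ltW.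
have wp := enorm_gt0 w0.
pose s := r / 2 / enorm w.
have s0 : 0 < s by rewrite !divr_gt0.
have sw' : s * enorm w = r / 2 by rewrite /s divfK// gt_eqF.
have sw : enorm (s *: w) = r / 2 by rewrite enormZ gtr0_norm.
have : enorm (s *: w) < r by rewrite sw; lra.
move=> /rP; rewrite sw => /ler_normlW.
have := Ham_ge (p + s *: w) vF; rewrite edotDl edotZl edotZr -dE (edotC d w).
have h1 : s * edot w v - s * edot w d = r / 2 * enorm w.
  by rewrite -mulrBr -edotNr -edotDr -sqr_enorm expr2 mulrA sw'.
have h2 : edot q d <= edot q v by rewrite vE; exact: Ham_ge.
have h3 : edot p (d - v) - edot q (d - v) <= enorm (q - p) * (2 * M).
  rewrite -edotNl -edotDl (enormB q p); apply: le_trans (edot_le _ _) _.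
  rewrite ler_wpM2l ?enorm_ge0//; apply: le_trans (enormD _ _) _.
  by rewrite enormN; have := FM _ dF; have := FM _ vF; lra.
move: h3; rewrite !(edotDr d) !edotNr => h3 h4 h5.
have h6 : r / 2 * enorm w <= r / 2 * e.
  have := enorm_ge0 (q - p); nra.
by move: h6; rewrite ler_pM2l// divr_gt0.
Qed.

End Hamiltonian.

(** * Shifting and concatenating trajectories *)

Section Shift.
Context {R : realType}.
Local Notation mu := (@lebesgue_measure R).

Let measurable_shift (c : R) :
  measurable_fun [set: measurableTypeR R] (+%R c : measurableTypeR R -> measurableTypeR R).
Proof.
apply: continuous_measurable_fun => t.
by apply: cvgD; [exact: cvg_cst|exact: cvg_id].
Qed.

#[local] Hint Extern 0 (measurable_fun _ (+%R _)) => solve [apply: measurable_shift] : core.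

(** The shifted measure agrees with Lebesgue measure on half-open intervals, which determine it. *)
Lemma lebesgue_measure_shift (c : R) (A : set R) : measurable A ->
  pushforward mu (+%R c : _ -> measurableTypeR R) A = mu A.
Proof.
move=> mA; apply/esym/lebesgue_measure_unique => //= _ [[a b]] _ <-; rewrite /pushforward.
rewrite (_ : +%R c @^-1` _ = `](a - c), (b - c)]%classic); last first.
  by apply/seteqP; split => t /=; rewrite !in_itv/= ltrBlDl lerBrDl.
by rewrite /= !lebesgue_measure_itv/= !lte_fin ltrD2r -!EFinB opprB addrA subrK.
Qed.

Lemma ae_shift (P : R -> Prop) (c : R) :
  {ae mu, forall t, P t} -> {ae mu, forall t, P (c + t)}.
Proof.
move=> [N [mN N0 NP]].
exists (+%R c @^-1` N); split; last by move=> t nPt; exact: NP.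
  by rewrite -[X in measurable X]setTI; exact: measurable_shift.
by rewrite -N0 -(lebesgue_measure_shift c mN).
Qed.

Lemma is_derive_shiftl (W : normedModType R) (f : R -> W) (c t : R) (d : W) :
  is_derive (c + t) 1 f d -> is_derive t 1 (fun s => f (c + s)) d.
Proof.
have e : (fun h => h^-1 *: (f (c + (h *: 1 + t)) - f (c + t))) =
         (fun h : R => h^-1 *: (f (h *: 1 + (c + t)) - f (c + t))).
  by apply/funext => h; rewrite addrCA.
by move=> [fd fE]; apply: DeriveDef; rewrite /derivable /derive e.
Qed.

End Shift.

Section Arcs.
Context {R : realType} {n : nat}.
Local Notation V := 'rV[R]_n.
Local Notation mu := (@lebesgue_measure R).
Implicit Types (f g : R -> V) (F : V -> set V).

Lemma abs_cont_arc_shift f (c a b : R) : abs_cont_arc f (c + a) (c + b) ->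
  abs_cont_arc (fun s => f (c + s)) a b.
Proof.
move=> fac e /fac[d d0 dP]; exists d => // k s t st dis le_d.
apply: (dP k (fun i => c + s i) (fun i => c + t i)).
- by move=> i /st [? [? ?]]; rewrite !lerD2l.
- by move=> i j ik jk ij; rewrite !lerD2l; exact: dis.
- rewrite (eq_bigr (fun i : 'I_k => t i - s i)) // => i _.
  by rewrite opprD addrACA subrr add0r.
Qed.

Lemma abs_cont_arcS f (a b a' b' : R) : a <= a' -> b' <= b ->
  abs_cont_arc f a b -> abs_cont_arc f a' b'.
Proof.
move=> aa bb fac e /fac[d d0 dP]; exists d => // k s t st dis le_d.
apply: dP => // i /st[? [? ?]]; split; [lra|split=> //; lra].
Qed.

(** Provides absolute continuity of products such as [edot (p t) (w t)], whose increments are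
    controlled by those of the factors once both are bounded. *)
Lemma abs_cont_arc_dominated (h : R -> R) f g (a b C : R) :
  abs_cont_arc f a b -> abs_cont_arc g a b ->
  (forall s t, a <= s -> s <= t -> t <= b ->
    `|h t - h s| <= C * (enorm (f t - f s) + enorm (g t - g s) + (t - s))) ->
  abs_cont h a b.
Proof.
move=> fac gac hC e e0.
have C0 : 0 < 3 * (`|C| + 1) by have := normr_ge0 C; lra.
have e3 : 0 < e / (3 * (`|C| + 1)) by rewrite divr_gt0.
have [d1 d10 P1] := fac _ e3; have [d2 d20 P2] := gac _ e3.
exists (Num.min (Num.min d1 d2) (e / (3 * (`|C| + 1)))).
  by rewrite !lt_min d10 d20 e3.
move=> k s t st dis; rewrite !lt_min => /andP[/andP[h1 h2] h3].
have := P1 k s t st dis h1; have := P2 k s t st dis h2.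
set E := e / _ in e3 h3 *; move=> g2 f1.
have eE : e = (`|C| + 1) * (E + E + E).
  by rewrite /E; field; have := normr_ge0 C; lra.
apply: (@le_lt_trans _ _ ((`|C| + 1) * \sum_(i < k)
    (enorm (f (t i) - f (s i)) + enorm (g (t i) - g (s i)) + (t i - s i)))).
  rewrite mulr_sumr; apply: ler_sum => i _; have [s1 [s2 s3]] := st i (ltn_ord i).
  apply: le_trans (hC _ _ s1 s2 s3) _; rewrite ler_wpM2r//.
    by apply: addr_ge0; [apply: addr_ge0; exact: enorm_ge0|rewrite subr_ge0].
  by have := ler_norm C; lra.
have C1 : 0 < `|C| + 1 by have := normr_ge0 C; lra.
by rewrite eE big_split big_split /= ltr_pM2l//; lra.
Qed.

Lemma trajectory_shift F f (c b : R) : 0 <= c -> trajectory F f (c + b) ->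
  trajectory F (fun s => f (c + s)) b.
Proof.
move=> c0 [fac fae]; split.
  by apply: abs_cont_arc_shift; apply: abs_cont_arcS fac => //; rewrite addr0.
have := ae_shift c fae; apply: (@filterS _ _ (ae_filter_ringOfSetsType mu)) => t h.
rewrite in_itv/= => /andP[t0 tb].
have [|d fd Fd] := h; first by rewrite in_itv/= addr_ge0//= lerD2l.
by exists d => //; exact: is_derive_shiftl.
Qed.

Lemma trajectoryS F f (a b : R) : a <= b -> trajectory F f b -> trajectory F f a.
Proof.
move=> ab [fac fae]; split; first exact: abs_cont_arcS fac.
apply: (@filterS _ _ (ae_filter_ringOfSetsType mu) _ _ _ fae) => t h.
rewrite in_itv/= => /andP[t0 ta]; apply: h.
by rewrite in_itv/= t0 (le_trans ta).
Qed.

Definition concat (c : R) f g : R -> V := fun s => if s <= c then f s else g (s - c).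

Lemma trajectory_concat F f g (a b : R) : 0 <= a -> 0 <= b ->
  trajectory F f a -> trajectory F g b -> f a = g 0 ->
  trajectory F (concat a f g) (a + b).
Proof.
move=> a0 b0 [fac fae] [gac gae] fg; split.
  move=> e e0; have e2 : 0 < e / 2 by rewrite divr_gt0.
  have [d1 d10 P1] := fac _ e2; have [d2 d20 P2] := gac _ e2.
  exists (Num.min d1 d2); first by rewrite lt_min d10.
  move=> k s t st dis; rewrite lt_min => /andP[h1 h2].
  (* Each interval is cut at the junction: [lo] keeps the part before [a], [hi] the part after it,
     shifted to start at 0. Both maps are nondecreasing, so disjoint families stay disjoint. *)
  pose lo r := Num.min r a; pose hi r := Num.max (r - a) 0.
  have lo_le r q : r <= q -> lo r <= lo q.
    by rewrite /lo /Order.min; case: ltP => ?; case: ltP => ? ?; lra.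
  have hi_le r q : r <= q -> hi r <= hi q.
    by rewrite /hi /Order.max; case: ltP => ?; case: ltP => ? ?; lra.
  have lohi r : r = lo r + hi r.
    by rewrite /lo /hi /Order.min /Order.max; case: ltP => ?; case: ltP => ?; lra.
  have loa r : lo r <= a by rewrite /lo ge_min lexx orbT.
  have hi0 r : 0 <= hi r by rewrite /hi le_max lexx orbT.
  have cE r : concat a f g r = f (lo r) + (g (hi r) - g 0).
    rewrite /concat /lo /hi; case: leP => ra.
      by rewrite max_r ?subrr ?addr0//; lra.
    by rewrite max_l ?fg ?[g 0 + _]addrC ?subrK//; lra.
  have f1 := P1 k (fun i => lo (s i)) (fun i => lo (t i)).
  have g1 := P2 k (fun i => hi (s i)) (fun i => hi (t i)).
  apply: (@le_lt_trans _ _ (\sum_(i < k) enorm (f (lo (t i)) - f (lo (s i))) +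
      \sum_(i < k) enorm (g (hi (t i)) - g (hi (s i))))).
    rewrite -big_split; apply: ler_sum => i _ /=; rewrite !cE.
    by rewrite opprD addrACA opprB subrKA enormD.
  have {}f1 : \sum_(i < k) enorm (f (lo (t i)) - f (lo (s i))) < e / 2.
    apply: f1.
    - by move=> i /st[? [? ?]]; split; [rewrite /lo le_min a0 andbT|split; [exact: lo_le|]].
    - by move=> i j ik jk ij; case: (dis i j ik jk ij) => ?; [left|right]; exact: lo_le.
    - apply: le_lt_trans h1; apply: ler_sum => i _; have [? [? ?]] := st i (ltn_ord i).
      have := hi_le (s i) (t i); have := lohi (s i); have := lohi (t i); lra.
  have {}g1 : \sum_(i < k) enorm (g (hi (t i)) - g (hi (s i))) < e / 2.
    apply: g1.
    - move=> i /st[? [? ?]]; split => //; split; first exact: hi_le.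
      by rewrite /hi ge_max b0 andbT; lra.
    - by move=> i j ik jk ij; case: (dis i j ik jk ij) => ?; [left|right]; exact: hi_le.
    - apply: le_lt_trans h2; apply: ler_sum => i _; have [? [? ?]] := st i (ltn_ord i).
      have := lo_le (s i) (t i); have := lohi (s i); have := lohi (t i); lra.
  lra.
have ga := ae_shift (- a) gae.
(* The junction, where the one-sided derivatives may differ, is a null set. *)
have na : {ae mu, forall t, t <> a}.
  exists [set a]; split; [exact: measurable_set1|exact: lebesgue_measure_set1|].
  by move=> t /= /contrapT.
move: fae ga na; apply: (@filterS3 _ _ (ae_filter_ringOfSetsType mu)) => t ft gt ta.
rewrite in_itv/= => /andP[t0 tb].
have [lt_ta|lt_at|//] := ltgtP t a.
  have [|d fd Fd] := ft; first by rewrite in_itv/= t0 ltW.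
  exists d; last by rewrite /concat ltW.
  apply: near_eq_is_derive fd.
  by apply: filterS (lt_nbhsl lt_ta) => s sa; rewrite /concat ltW.
have [|d gd Fd] := gt; first by rewrite in_itv/=; apply/andP; split; lra.
exists d; last by rewrite /concat leNgt lt_at/= addrC.
apply: near_eq_is_derive (is_derive_shiftl gd).
by apply: filterS (lt_nbhsr lt_at) => s sa; rewrite /concat leNgt sa/= addrC.
Qed.

Lemma min_time_le F (S : set V) f (b : R) : 0 < b -> trajectory F f b -> S (f b) ->
  (min_time F S (f 0%R) <= b%:E)%E.
Proof. by move=> b0 ft Sf; apply: ereal_inf_lbound; exists b => //; split=> //; exists f. Qed.

(** Dynamic programming along an optimal arc: the tail reaches [S] in time [T - t], and a faster arc
    from [f t], appended to the initial piece, would beat [T]. *)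
Lemma min_time_along F (S : set V) f (T t : R) : trajectory F f T -> S (f T) ->
  min_time F S (f 0) = T%:E -> 0 <= t < T -> min_time F S (f t) = (T - t)%:E.
Proof.
move=> ft Sf fT /andP[t0 tT]; apply/eqP; rewrite eq_le; apply/andP; split.
  have fs : trajectory F (fun s => f (t + s)) (T - t).
    by apply: trajectory_shift => //; rewrite addrC subrK.
  have := @min_time_le F S _ (T - t) _ fs; rewrite addr0 [t + _]addrC subrK; apply => //.
  by rewrite subr_gt0.
apply: le_ereal_inf_tmp => _ [b [b0 [g [gt [g0 Sg]]]] <-].
have := @min_time_le F S (concat t f g) (t + b).
rewrite /concat t0 fT lee_fin lee_fin lerBlDl; apply.
- by rewrite ltr_wpDl.
- by apply: trajectory_concat => //; [exact: ltW|apply: trajectoryS ft; exact: ltW].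
- by rewrite ifF; [rewrite addrAC subrr add0r|apply/negbTE; rewrite -ltNge ltrDl].
Qed.

End Arcs.

(** * Bounds along arcs and flows *)

Section ArcBounds.
Context {R : realType} {n : nat}.
Local Notation V := 'rV[R]_n.
Local Notation mu := (@lebesgue_measure R).
Implicit Types (f g : R -> V).

Lemma clamp_itv (a b s : R) : a <= b -> a <= clamp a b s <= b.
Proof. by move=> ab; rewrite /clamp le_max lexx ge_max ab ge_min lexx orbT. Qed.

Lemma clamp_id (a b s : R) : a <= s <= b -> clamp a b s = s.
Proof. by move=> /andP[as_ sb]; rewrite /clamp min_l// max_r. Qed.

Lemma clamp_ge (a b s : R) : a <= b -> b <= s -> clamp a b s = b.
Proof. by move=> ab bs; rewrite /clamp min_r// max_r. Qed.

Lemma abs_cont_arc_clamp f (a b : R) : a <= b -> abs_cont_arc f a b ->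
  continuous (fun s => f (clamp a b s)).
Proof.
move=> ab fac t; apply/continuous_enormP => e e0.
have [r r0 rP] := fac e e0.
have dist s u : a <= s -> s <= u -> u <= b -> u - s < r -> enorm (f u - f s) < e.
  move=> as_ su ub usr.
  have := rP 1%N (fun=> s) (fun=> u); rewrite !big_ord1; apply => //.
  by move=> [|i] [|j].
have /cvgrPdist_lt/(_ r r0) : x @[x --> t] --> t by exact: cvg_id.
apply: filterS => s /(le_lt_trans (dist_clamp a b t s)).
have /andP[s1 s2] := clamp_itv s ab; have /andP[t1 t2] := clamp_itv t ab.
rewrite ltr_norml => /andP[h1 h2].
have [st|/ltW ts] := leP (clamp a b s) (clamp a b t).
  by rewrite enormB; apply: dist.
by apply: dist => //; lra.
Qed.

Lemma abs_cont_arc_bounded f (a b : R) : a <= b -> abs_cont_arc f a b ->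
  exists2 M : R, 0 <= M & forall t, a <= t <= b -> enorm (f t) <= M.
Proof.
move=> ab fac.
have cf : continuous (fun s => enorm (f (clamp a b s))).
  move=> s; have cs := @abs_cont_arc_clamp f a b ab fac s.
  exact: (cvg_comp _ _ cs (@continuous_enorm _ _ (f (clamp a b s)))).
have [c cab cmax] := EVT_max ab (continuous_subspaceT cf).
exists (enorm (f (clamp a b c))); first exact: enorm_ge0.
by move=> t tab; have := cmax t; rewrite in_itv /= clamp_id//; exact.
Qed.

Lemma lipschitz_abs_cont_arc f (a b M : R) :
  (forall s t, a <= s -> s <= t -> t <= b -> enorm (f t - f s) <= M * (t - s)) ->
  abs_cont_arc f a b.
Proof.
move=> fM e e0; have M0 : 0 < `|M| + 1 by have := normr_ge0 M; lra.
exists (e / (`|M| + 1)); first by rewrite divr_gt0.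
move=> k s t st _; rewrite ltr_pdivlMr// mulrC; apply: le_lt_trans.
rewrite mulr_sumr; apply: ler_sum => i _; have [s1 [s2 s3]] := st i (ltn_ord i).
apply: le_trans (fM _ _ s1 s2 s3) _; rewrite ler_wpM2r ?subr_ge0//.
by have := ler_norm M; lra.
Qed.

(** The function [C * t - edot w (f t)] has a nonnegative derivative almost everywhere. *)
Lemma abs_cont_arc_edot_le f (a b C : R) (w : V) : a <= b -> abs_cont_arc f a b ->
  {ae mu, forall t, t \in `[a, b] -> exists2 d, is_derive t 1 f d & edot w d <= C} ->
  edot w (f b - f a) <= C * (b - a).
Proof.
move=> ab fac fae.
have hac : abs_cont (fun t => C * t - edot w (f t)) a b.
  apply: (@abs_cont_arc_dominated _ _ _ f f a b (`|C| + enorm w)) => // s t as_ st tb.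
  rewrite (_ : _ - _ = C * (t - s) - edot w (f t - f s)); last by rewrite edotDr edotNr; ring.
  apply: le_trans (ler_normB _ _) _; rewrite normrM (ger0_norm (_ : 0 <= t - s)) ?subr_ge0//.
  have := normr_edot_le w (f t - f s); have := enorm_ge0 w; have := normr_ge0 C.
  have := enorm_ge0 (f t - f s); have : 0 <= t - s by rewrite subr_ge0.
  nra.
have := abs_cont_ae_nondecreasing ab hac; rewrite edotDr edotNr => h.
suff : C * a - edot w (f a) <= C * b - edot w (f b) by lra.
apply: h; apply: (@filterS _ _ (ae_filter_ringOfSetsType mu) _ _ _ fae) => t ft tab.
have [d fd dC] := ft tab; exists (C - edot w d); last by rewrite subr_ge0.
apply: is_deriveB.
  exact: is_derive_mull.
have := @is_derive_edot _ _ (cst w) f t 0 d (is_derive_cst _ _ _) fd.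
by rewrite edot0l add0r.
Qed.

Lemma abs_cont_arc_lipschitz f (a b M : R) : a <= b -> abs_cont_arc f a b ->
  {ae mu, forall t, t \in `[a, b] -> exists2 d, is_derive t 1 f d & enorm d <= M} ->
  enorm (f b - f a) <= M * (b - a).
Proof.
move=> ab fac fae; set w := f b - f a.
have [->|w0] := eqVneq w 0.
  rewrite enorm0.
  have := @abs_cont_arc_edot_le f a b M 0 ab fac.
  rewrite edot0l; apply; apply: (@filterS _ _ (ae_filter_ringOfSetsType mu) _ _ _ fae).
  move=> t ft /ft [d fd dM]; exists d => //; rewrite edot0l.
  exact: le_trans (enorm_ge0 _) dM.
have wp := enorm_gt0 w0; rewrite -(ler_pM2l wp) -expr2 sqr_enorm mulrA.
apply: abs_cont_arc_edot_le => //.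
apply: (@filterS _ _ (ae_filter_ringOfSetsType mu) _ _ _ fae).
move=> t ft /ft [d fd dM]; exists d => //.
by apply: le_trans (edot_le _ _) _; rewrite ler_pM2l.
Qed.

End ArcBounds.

(** * Flows selected from [F]: growth, Lipschitz bound, existence *)

Section Flow.
Context {R : realType} {n : nat}.
Local Notation V := 'rV[R]_n.
Variables (F : V -> set V) (K K1 : R).
Hypothesis F0 : forall y, F y !=set0.
Hypothesis Fc : forall y, compact (F y).
Hypothesis K0 : 0 < K.
Hypothesis FK : lipschitz_multi F K.
(** Gronwall for [r^2 + 1] with [r = |Y - z|]: the speed is at most [M + K r], and the added 1
    absorbs the linear term, since [(M + K r) r <= (M + K) (r^2 + 1)]. *)
Lemma flow_growth (Y v : R -> V) (z : V) (M t : R) : 0 <= M -> 0 <= t ->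
  (forall w, F z w -> enorm w <= M) ->
  (forall s : R, 0 <= s -> is_derive s 1 Y (v s) /\ F (Y s) (v s)) ->
  enorm (Y t - z) ^+ 2 + 1 <= (enorm (Y 0 - z) ^+ 2 + 1) * expR (2 * (M + K) * t).
Proof.
move=> M0 t0 FM dY; set c := 2 * (M + K).
have dE (s : R) := is_derive_expR_mull (- c) s.
have dN (s : R) : 0 <= s -> is_derive s 1 (fun s => - (edot (Y s - z) (Y s - z) + 1))
    (- (2 * edot (v s) (Y s - z))).
  move=> s0; have [dYs _] := dY s s0.
  have dYz : is_derive s 1 (fun s => Y s - z) (v s).
    by have := is_deriveB dYs (is_derive_cst z s 1); rewrite subr0.
  apply: is_deriveN; apply: is_derive_eq.
    by apply: is_deriveD (is_derive_edot dYz dYz) _; exact: is_derive_cst.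
  by rewrite addr0 (edotC (Y s - z)); ring.
have := @is_derive_le _ (fun s => - (edot (Y s - z) (Y s - z) + 1) * expR (- c * s))
  (fun s => (c * (edot (Y s - z) (Y s - z) + 1) - 2 * edot (v s) (Y s - z)) * expR (- c * s))
  0 t t0.
rewrite mulr0 expR0 mulr1 !sqr_enorm => h.
have {}h : - (edot (Y 0 - z) (Y 0 - z) + 1) <= - (edot (Y t - z) (Y t - z) + 1) * expR (- c * t).
  apply: h => s /andP[s0 _].
    apply: is_derive_eq (is_deriveM (dN s s0) (dE s)) _.
    by rewrite /GRing.scale /=; ring.
  rewrite mulr_ge0 ?expR_ge0// subr_ge0 -sqr_enorm.
  have vM := F_growth FK FM (dY s s0).2.
  have := edot_le (v s) (Y s - z); have := enorm_ge0 (Y s - z).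
  rewrite /c; move: (enorm (Y s - z)) vM => r vM r0 /le_trans.
  have : enorm (v s) * r <= (M + K * r) * r by rewrite ler_wpM2r.
  have : 0 <= M * (r ^+ 2 - r + 1).
    by apply: mulr_ge0 => //; have := sqr_ge0 (r - 1 / 2); lra.
  move=> h1 h2 /(_ _ h2) h3.
  have e : (M + K) * (r ^+ 2 + 1) = (M + K * r) * r + M * (r ^+ 2 - r + 1) + K by ring.
  by have k0 := ltW K0; clear dY dE dN; lra.
rewrite -(ler_pM2r (expR_gt0 (- c * t))) -mulrA -expRD mulNr subrr expR0 mulr1.
by move: h; clear dY dE dN; rewrite !mulNr; lra.
Qed.

(** The speed is at most [M + K |Y - z|], and [r <= r^2 + 1] turns the growth estimate into a
    constant. It depends on the starting point only through [rho], hence is uniform over a ball. *)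
Lemma flow_lipschitz (Y v : R -> V) (z : V) (M rho tau : R) : 0 <= M -> 0 <= tau ->
  (forall w, F z w -> enorm w <= M) ->
  (forall s : R, 0 <= s -> is_derive s 1 Y (v s) /\ F (Y s) (v s)) ->
  enorm (Y 0 - z) <= rho ->
  forall s t, 0 <= s -> s <= t -> t <= tau ->
    enorm (Y t - Y s) <= (M + K * ((rho ^+ 2 + 1) * expR (2 * (M + K) * tau))) * (t - s).
Proof.
move=> M0 tau0 FM dY rhoP s t s0 st ttau.
set C := M + _.
have := @enorm_increment_le _ _ Y v (fun r => C * r) (fun=> C) s t st.
rewrite mulrBr; apply.
- by move=> r /andP[sr _]; apply: (dY r _).1; exact: le_trans sr.
- by move=> r _; exact: is_derive_mull.
move=> r /andP[sr rt]; have r0 := le_trans s0 sr.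
apply: le_trans (F_growth FK FM (dY r r0).2) _; rewrite lerD2l ler_pM2l//.
have g := flow_growth M0 r0 FM dY.
have h : enorm (Y r - z) <= enorm (Y r - z) ^+ 2 + 1.
  by have := sqr_ge0 (enorm (Y r - z) - 1 / 2); have := enorm_ge0 (Y r - z); lra.
apply: le_trans h (le_trans g _).
have rho0 := le_trans (enorm_ge0 _) rhoP.
apply: ler_pM; rewrite ?expR_ge0//.
- by rewrite addr_ge0 ?sqr_ge0.
- by rewrite lerD2r ler_pXn2r// nnegrE enorm_ge0.
- rewrite ler_expR ler_wpM2l//; last exact: le_trans ttau.
  by rewrite mulr_ge0// addr_ge0// ltW.
Qed.

Hypothesis K10 : 0 <= K1.
Hypothesis Fgrad : forall q, q != 0 -> forall y, exists d, grad_at (Ham F y) q d.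
Hypothesis FgradK : forall q y z dy dz, q != 0 ->
  grad_at (Ham F y) q dy -> grad_at (Ham F z) q dz ->
  enorm (dy - dz) <= K1 * enorm (y - z).

Lemma max_flow (q : R -> V) (y0 : V) : continuous q -> (forall s, q s != 0) ->
  exists Y v : R -> V, Y 0 = y0 /\ forall t : R, 0 <= t ->
    is_derive t 1 Y (v t) /\ grad_at (Ham F (Y t)) (q t) (v t).
Proof.
move=> cq q0.
have /choice[g gP] : forall sy : R * V, exists d, grad_at (Ham F sy.2) (q sy.1) d.
  by move=> [s y]; exact: Fgrad.
have [M M0 FM] := F_bounded F0 Fc y0.
(* The Picard weight needs a positive Lipschitz constant, hence [K1 + 1]. *)
have L0 : 0 < K1 + 1 by rewrite ltr_wpDl.
have gc (y : V) : continuous (fun s => g (s, y)).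
  move=> t; apply/continuous_enormP => e e0.
  have e2 : 0 < e / 2 by rewrite divr_gt0.
  have [r r0 rP] := argmax_continuous F0 Fc (gP (t, y)) e2.
  have := iffLR (continuous_enormP q t) (cq t) r r0; apply: filterS => s qs.
  have [gF gE] := grad_at_argmax F0 Fc (gP (s, y)).
  by have /= := rP _ _ qs gF gE => /le_lt_trans; apply; lra.
have gL s y z : enorm (g (s, y) - g (s, z)) <= (K1 + 1) * enorm (y - z).
  apply: le_trans (FgradK (q0 s) (gP (s, y)) (gP (s, z))) _.
  by rewrite ler_wpM2r ?enorm_ge0//; lra.
have gM s : enorm (g (s, y0)) <= M.
  by apply: FM; case: (grad_at_argmax F0 Fc (gP (s, y0))).
have [Y [Y0 dY]] := picard_lindelof L0 gc gL gM.
by exists Y, (fun t => g (t, Y t)); split => // t t0; split; [exact: dY|exact: (gP (t, Y t))].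
Qed.

End Flow.

(** * Comparison of two arcs: Gronwall and pairing estimates *)

Section ArcComparison.
Context {R : realType} {n : nat}.
Local Notation V := 'rV[R]_n.
Local Notation mu := (@lebesgue_measure R).
Implicit Types (f g w p x : R -> V).

Lemma abs_cont_arcB f g (a b : R) : abs_cont_arc f a b -> abs_cont_arc g a b ->
  abs_cont_arc (fun t => f t - g t) a b.
Proof.
move=> fac gac e e0; have e2 : 0 < e / 2 by rewrite divr_gt0.
have [d1 d10 P1] := fac _ e2; have [d2 d20 P2] := gac _ e2.
exists (Num.min d1 d2); first by rewrite lt_min d10.
move=> k s t st dis; rewrite lt_min => /andP[h1 h2].
have {}P1 := P1 k s t st dis h1; have {}P2 := P2 k s t st dis h2.
apply: (@le_lt_trans _ _ (\sum_(i < k) (enorm (f (t i) - f (s i)) + enorm (g (t i) - g (s i))))).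
  apply: ler_sum => i _; rewrite opprD addrACA -opprD.
  by apply: le_trans (enormD _ _) _; rewrite enormN.
by rewrite big_split /=; lra.
Qed.

Lemma abs_cont_sqr_exp w (T W c : R) : 0 <= c ->
  abs_cont_arc w 0 T -> (forall t, 0 <= t <= T -> enorm (w t) <= W) ->
  abs_cont (fun t => - edot (w t) (w t) * expR (- c * t)) 0 T.
Proof.
move=> c0 wac wW.
apply: (@abs_cont_arc_dominated _ _ _ w w 0 T (W + W ^+ 2 * c)) => // s t s0 st tT.
have sW : enorm (w s) <= W by apply: wW; rewrite s0 (le_trans st).
have tW : enorm (w t) <= W by apply: wW; rewrite tT (le_trans s0).
have W0 := le_trans (enorm_ge0 _) sW.
have E1 : expR (- c * t) <= 1 by rewrite -expR0 ler_expR mulNr oppr_le0 mulr_ge0// (le_trans s0).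
have Es1 : expR (- c * s) <= 1 by rewrite -expR0 ler_expR mulNr oppr_le0 mulr_ge0.
have Et : expR (- c * t) = expR (- c * s) * expR (- c * (t - s)).
  by rewrite -expRD; congr expR; ring.
have E2 : expR (- c * s) - expR (- c * t) <= c * (t - s).
  have := expR_ge1Dx (- c * (t - s)); rewrite Et.
  have : 0 <= c * (t - s) by rewrite mulr_ge0// subr_ge0.
  have := expR_ge0 (- c * s); move: (expR (- c * s)) (expR (- c * (t - s))) Es1 => A B A1 A0 ct0 B1.
  have : A * (1 + - c * (t - s)) <= A * B by rewrite ler_wpM2l.
  have : A * (c * (t - s)) <= 1 * (c * (t - s)) by rewrite ler_wpM2r.
  lra.
have E3 : expR (- c * t) <= expR (- c * s) by rewrite ler_expR !mulNr lerN2 ler_wpM2l.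
rewrite (_ : _ - _ = - (edot (w t - w s) (w t + w s) * expR (- c * t))
   + edot (w s) (w s) * (expR (- c * s) - expR (- c * t))); last first.
  by rewrite edotDr !edotDl !edotNl (edotC (w s) (w t)); ring.
apply: le_trans (ler_normD _ _) _; rewrite normrN !normrM.
have -> : `|expR (- c * t)| = expR (- c * t) by apply: ger0_norm; exact: expR_ge0.
have -> : `|edot (w s) (w s)| = edot (w s) (w s) by apply: ger0_norm; exact: edotvv_ge0.
rewrite [`|_ - expR _|]ger0_norm ?subr_ge0//.
rewrite -sqr_enorm.
have h1 : `|edot (w t - w s) (w t + w s)| <= enorm (w t - w s) * (W + W).
  apply: le_trans (normr_edot_le _ _) _; rewrite ler_wpM2l ?enorm_ge0//.
  by apply: le_trans (enormD _ _) _; rewrite lerD.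
have h2 : `|edot (w t - w s) (w t + w s)| * expR (- c * t) <= `|edot (w t - w s) (w t + w s)|.
  by rewrite -[leRHS]mulr1 ler_wpM2l.
have h3 : enorm (w s) ^+ 2 * (expR (- c * s) - expR (- c * t)) <= W ^+ 2 * (c * (t - s)).
  apply: ler_pM => //; rewrite ?sqr_ge0 ?subr_ge0//.
  by rewrite ler_pXn2r// nnegrE enorm_ge0.
have h4 : 0 <= W * (t - s) by rewrite mulr_ge0// subr_ge0.
have h5 : 0 <= W ^+ 2 * c * (enorm (w t - w s) + enorm (w t - w s)).
  by apply: mulr_ge0; [rewrite mulr_ge0// sqr_ge0|rewrite addr_ge0// enorm_ge0].
lra.
Qed.

(** The function [- |w|^2 exp (- 2 k t)] is nondecreasing; squaring avoids the nondifferentiability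
    of the norm at 0. *)
Lemma arc_gronwall w (T k : R) : 0 <= T -> 0 <= k -> abs_cont_arc w 0 T ->
  {ae mu, forall t, t \in `[0, T] -> exists2 d, is_derive t 1 w d & enorm d <= k * enorm (w t)} ->
  enorm (w T) <= enorm (w 0) * expR (k * T).
Proof.
move=> T0 k0 wac wae; have [W W0 wW] := abs_cont_arc_bounded T0 wac.
have c0 : 0 <= 2 * k by rewrite mulr_ge0.
have := abs_cont_ae_nondecreasing T0 (abs_cont_sqr_exp c0 wac wW).
rewrite mulr0 expR0 mulr1 => h.
have {}h : - edot (w 0) (w 0) <= - edot (w T) (w T) * expR (- (2 * k) * T).
  apply: h; apply: (@filterS _ _ (ae_filter_ringOfSetsType mu) _ _ _ wae) => t wt tT.
  have [d dw dk] := wt tT.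
  have dE := is_derive_expR_mull (- (2 * k)) t.
  exists ((2 * k * edot (w t) (w t) - 2 * edot d (w t)) * expR (- (2 * k) * t)).
    have dN : is_derive t 1 (fun s => - edot (w s) (w s)) (- (edot d (w t) + edot (w t) d)).
      exact: is_deriveN (is_derive_edot dw dw).
    apply: is_derive_eq (is_deriveM dN dE) _.
    by rewrite (edotC (w t) d) /GRing.scale /=; ring.
  rewrite mulr_ge0 ?expR_ge0// subr_ge0 -mulrA ler_pM2l// -sqr_enorm.
  by apply: le_trans (edot_le _ _) _; rewrite expr2 mulrA ler_wpM2r// enorm_ge0.
rewrite -(@ler_pXn2r _ 2)// ?nnegrE ?mulr_ge0 ?enorm_ge0 ?expR_ge0//.
have e : expR (k * T) ^+ 2 * expR (- (2 * k) * T) = 1.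
  by rewrite -expRM_natl -expRD -expR0; congr expR; ring.
rewrite exprMn !sqr_enorm -(ler_pM2r (expR_gt0 (- (2 * k) * T))) -[leRHS]mulrA e mulr1.
by move: h; rewrite !mulNr; lra.
Qed.

(** The almost everywhere hypothesis is the sign of the derivative of [edot (p t) (w t) + C * t]. *)
Lemma arc_pairing_le p w (T C : R) : 0 <= T ->
  abs_cont_arc p 0 T -> abs_cont_arc w 0 T ->
  {ae mu, forall t, t \in `[0, T] -> exists pd wd : V,
     [/\ is_derive t 1 p pd, is_derive t 1 w wd &
         0 <= edot pd (w t) + edot (p t) wd + C]} ->
  edot (p 0) (w 0) <= edot (p T) (w T) + C * T.
Proof.
move=> T0 pac wac pwae.
have [P P0 pP] := abs_cont_arc_bounded T0 pac.
have [W W0 wW] := abs_cont_arc_bounded T0 wac.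
have hac : abs_cont (fun t => edot (p t) (w t) + C * t) 0 T.
  apply: (@abs_cont_arc_dominated _ _ _ p w 0 T (P + W + `|C|)) => // s t s0 st tT.
  have sW : enorm (w s) <= W by apply: wW; rewrite s0 (le_trans st).
  have tP : enorm (p t) <= P by apply: pP; rewrite tT (le_trans s0).
  rewrite (_ : _ - _ = edot (p t) (w t - w s) + edot (p t - p s) (w s) + C * (t - s)); last first.
    by rewrite edotDr edotNr edotDl edotNl; ring.
  have C0 := normr_ge0 C; have ts0 : 0 <= t - s by rewrite subr_ge0.
  have h1 : `|edot (p t) (w t - w s)| <= P * enorm (w t - w s).
    by apply: le_trans (normr_edot_le _ _) _; rewrite ler_wpM2r// enorm_ge0.
  have h2 : `|edot (p t - p s) (w s)| <= W * enorm (p t - p s).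
    by apply: le_trans (normr_edot_le _ _) _; rewrite mulrC ler_wpM2r// enorm_ge0.
  have h3 : `|C * (t - s)| = `|C| * (t - s) by rewrite normrM (ger0_norm ts0).
  apply: le_trans (ler_normD _ _) _; rewrite h3.
  apply: le_trans (lerD (ler_normD _ _) (lexx _)) _.
  have e1 := enorm_ge0 (p t - p s); have e2 := enorm_ge0 (w t - w s).
  move: (enorm (p t - p s)) (enorm (w t - w s)) (t - s) `|C| h1 h2 e1 e2 C0 ts0
    => a b c D h1 h2 a0 b0 D0 cc0.
  have := mulr_ge0 P0 a0; have := mulr_ge0 P0 cc0; have := mulr_ge0 W0 b0.
  have := mulr_ge0 W0 cc0; have := mulr_ge0 D0 a0; have := mulr_ge0 D0 b0.
  lra.
have := abs_cont_ae_nondecreasing T0 hac; rewrite mulr0 addr0; apply.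
apply: (@filterS _ _ (ae_filter_ringOfSetsType mu) _ _ _ pwae) => t h /h[pd [wd [dp dw h0]]].
exists (edot pd (w t) + edot (p t) wd + C) => //.
apply: is_deriveD (is_derive_edot dp dw) _.
exact: is_derive_mull.
Qed.

End ArcComparison.

(** * The minimum time function *)

Section MinTime.
Context {R : realType} {n : nat}.
Local Notation V := 'rV[R]_n.
Local Notation mu := (@lebesgue_measure R).
Variables (F : V -> set V) (K c0 K1 : R) (S : set V).
Hypothesis F0 : forall y, F y !=set0.
Hypothesis Fc : forall y, compact (F y).
Hypothesis K0 : 0 < K.
Hypothesis FK : lipschitz_multi F K.

Lemma flow_trajectory (Y v : R -> V) (tau : R) : 0 <= tau ->
  (forall s : R, 0 <= s -> is_derive s 1 Y (v s) /\ F (Y s) (v s)) ->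
  trajectory F Y tau.
Proof.
move=> tau0 dY; have [M M0 FM] := F_bounded F0 Fc (Y 0); split.
  apply: lipschitz_abs_cont_arc => s t s0 st ttau.
  have rho0 : enorm (Y 0 - Y 0) <= 0 by rewrite subrr enorm0.
  exact: (flow_lipschitz K0 FK M0 tau0 FM dY rho0 s0 st ttau).
apply: (@filterE _ _ (ae_filter_ringOfSetsType mu)) => t.
by rewrite in_itv/= => /andP[t0 _]; have [? ?] := dY t t0; exists (v t).
Qed.

(** Before time [alpha] the arc cannot be in [S], as this would make the minimum time smaller than
    [alpha]; at [alpha] itself it may be, so only membership in the closure survives. *)
Lemma closure_before_min_time (Y : R -> V) (alpha : R) : 0 < alpha ->
  (forall tau, 0 < tau -> trajectory F Y tau) -> {for alpha, continuous Y} ->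
  (alpha%:E <= min_time F S (Y 0%R))%E -> closure (~` S) (Y alpha).
Proof.
move=> a0 Ytr cY aT B /cY/nbhs_ballP[r /= r0 rB].
have [h [h0 hr ha]] : exists h : R, [/\ 0 < h, h < r & h < alpha].
  exists (Num.min r alpha / 2).
  have m0 : 0 < Num.min r alpha by rewrite lt_min r0.
  have mr : Num.min r alpha <= r by rewrite ge_min lexx.
  have ma : Num.min r alpha <= alpha by rewrite ge_min lexx orbT.
  by split; lra.
exists (Y (alpha - h)); split.
  move=> /= Sh; have ah : 0 < alpha - h by rewrite subr_gt0.
  have := le_trans aT (min_time_le ah (Ytr _ ah) Sh).
  by rewrite lee_fin lerBrDr gerDl leNgt h0.
by apply: rB; rewrite /ball /= opprB addrC subrK gtr0_norm.
Qed.

Hypothesis c00 : 0 <= c0.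
Hypothesis Hsc : forall q, semiconvex (fun y => Ham F y q) (c0 * enorm q).
Hypothesis K10 : 0 <= K1.
Hypothesis Fgrad : forall q, q != 0 -> forall y, exists d, grad_at (Ham F y) q d.
Hypothesis FgradK : forall q y z dy dz, q != 0 ->
  grad_at (Ham F y) q dy -> grad_at (Ham F z) q dz ->
  enorm (dy - dz) <= K1 * enorm (y - z).

(** Both velocities maximize against the same [p t], so [edot (p t) (v t - xd)] is the difference of
    [Ham] between [Y t] and [x t], exactly what the Clarke inequality for [- pd] bounds from
    below. *)
Lemma flow_adjoint_le (x p Y v : R -> V) (T P : R) : 0 <= T ->
  abs_cont_arc x 0 T -> abs_cont_arc p 0 T ->
  (forall t, 0 <= t <= T -> p t != 0) ->
  (forall t, 0 <= t <= T -> enorm (p t) <= P) ->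
  {ae mu, forall t, t \in `[0, T] ->
      exists2 xd, is_derive t 1 x xd & grad_at (Ham F (x t)) (p t) xd} ->
  {ae mu, forall t, t \in `[0, T] ->
      exists2 pd, is_derive t 1 p pd &
        clarke_grad (fun y => Ham F y (p t)) (x t) (- pd)} ->
  abs_cont_arc Y 0 T ->
  (forall t : R, 0 <= t <= T -> is_derive t 1 Y (v t) /\ grad_at (Ham F (Y t)) (p t) (v t)) ->
  enorm (Y T - x T) <= expR (K1 * T) * enorm (Y 0 - x 0) /\
  edot (p 0) (Y 0 - x 0) <= edot (p T) (Y T - x T)
    + c0 * P * expR (K1 * T) ^+ 2 * T * enorm (Y 0 - x 0) ^+ 2.
Proof.
move=> T0 xac pac p0 pP xae pae Yac dY.
set d := enorm (Y 0 - x 0); set G := expR (K1 * T).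
have wac := abs_cont_arcB Yac xac.
have wG t : 0 <= t <= T -> enorm (Y t - x t) <= G * d.
  move=> /andP[t0 tT].
  have := @arc_gronwall _ _ (fun s => Y s - x s) t K1 t0 K10 _ _.
  rewrite -/d => h; apply: (@le_trans _ _ (d * expR (K1 * t))).
    apply: h; first exact: abs_cont_arcS wac.
    apply: (@filterS _ _ (ae_filter_ringOfSetsType mu) _ _ _ xae) => s hs.
    rewrite in_itv/= => /andP[s0 st]; have sT := le_trans st tT.
    have s0T : 0 <= s <= T by rewrite s0 sT.
    have [xd dx gx] := hs s0T; have [dYs gY] := dY s s0T.
    exists (v s - xd); first exact: is_deriveB.
    exact: (FgradK (p0 s s0T) gY gx).
  by rewrite mulrC ler_wpM2r ?enorm_ge0// ler_expR ler_wpM2l.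
split; first by apply: wG; rewrite T0 lexx.
(* [G * d] bounds [|Y - x|] on all of [[0, T]], so [C] bounds the semiconvexity error at every
   time. *)
set C := c0 * P * (G * d) ^+ 2.
have -> : c0 * P * G ^+ 2 * T * d ^+ 2 = C * T by rewrite /C; ring.
apply: (@arc_pairing_le _ _ p (fun s => Y s - x s) T C T0 pac wac).
apply: (@filterS2 _ _ (ae_filter_ringOfSetsType mu) _ _ _ _ xae pae) => t hx hp tT.
have [xd dx gx] := hx tT; have [pd dp gp] := hp tT.
have {}tT : 0 <= t <= T by move: tT; rewrite in_itv.
have [dYt gY] := dY t tT.
exists pd, (v t - xd); split => //; first exact: is_deriveB.
have [_ YE] := grad_at_argmax F0 Fc gY; have [_ xE] := grad_at_argmax F0 Fc gx.
have c0p : 0 <= c0 * enorm (p t) by rewrite mulr_ge0// enorm_ge0.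
have := clarke_grad_semiconvex (Y t) c0p (Hsc (p t)) gp.
rewrite edotNl -YE -xE (edotDr (v t)) edotNr.
have h1 : c0 * enorm (p t) * enorm (Y t - x t) ^+ 2 <= C.
  rewrite /C; apply: ler_pM => //; rewrite ?sqr_ge0//.
    by rewrite ler_wpM2l// pP.
  by rewrite ler_pXn2r ?nnegrE ?enorm_ge0 ?mulr_ge0 ?expR_ge0 ?enorm_ge0// wG.
lra.
Qed.

(** The error is the Lipschitz constant [K |q|] of [Ham] in space, times a bound for the distance of
    [Y] from [z] between the two times, times the elapsed time. *)
Lemma flow_endpoint_ge (Y v : R -> V) (z q : V) (T alpha M : R) : 0 <= M ->
  0 <= T -> 0 <= alpha ->
  (forall s : R, 0 <= s -> is_derive s 1 Y (v s) /\ F (Y s) (v s)) ->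
  (forall s, T <= s <= alpha -> edot q (v s) = Ham F (Y s) q) ->
  (forall s, T <= s <= alpha -> enorm (Y s - Y T) <= M * `|alpha - T|) ->
  (forall s, alpha <= s <= T -> enorm (Y s - Y T) <= M * `|alpha - T|) ->
  Ham F z q * (alpha - T)
    - K * enorm q * (enorm (Y T - z) + M * `|alpha - T|) * `|alpha - T|
  <= edot q (Y alpha - Y T).
Proof.
move=> M0 T0 a0 dY vmax YM YM'; set b := `|alpha - T|; set A := enorm _ + _.
have YA s : enorm (Y s - Y T) <= M * b -> enorm (Y s - z) <= A.
  by have := enorm_dist (Y s) (Y T) z; rewrite /A; lra.
have HA s : enorm (Y s - z) <= A -> `|Ham F (Y s) q - Ham F z q| <= K * enorm q * A.
  move=> sA; have h : K * enorm q * enorm (Y s - z) <= K * enorm q * A.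
    by rewrite ler_wpM2l// mulr_ge0 ?enorm_ge0// ltW.
  have := Ham_lipschitz F0 Fc FK (Y s) z q; have := Ham_lipschitz F0 Fc FK z (Y s) q.
  rewrite (enormB z) ler_norml; move: h => ? ? ?; apply/andP; split; lra.
have dq (s : R) : 0 <= s -> is_derive s 1 (fun r => edot q (Y r)) (edot q (v s)).
  move=> s0; have := @is_derive_edot _ _ (cst q) Y s 0 (v s) (is_derive_cst _ _ _) (dY s s0).1.
  by rewrite edot0l add0r.
have dl (k s : R) : is_derive s 1 (fun r : R => k * r) k.
  exact: is_derive_mull.
set h := Ham F z q; set e := K * enorm q * A.
rewrite edotDr edotNr; have [aT|/ltW aT] := leP T alpha.
  have bE : b = alpha - T by rewrite /b ger0_norm// subr_ge0.
  have le := @is_derive_le _ (fun s => edot q (Y s) - (h - e) * s)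
    (fun s => edot q (v s) - (h - e)) T alpha aT.
  suff : edot q (Y T) - (h - e) * T <= edot q (Y alpha) - (h - e) * alpha.
    by rewrite bE; lra.
  apply: le => s sTa; have /andP[Ts sa] := sTa.
    exact: is_deriveB (dq s (le_trans T0 Ts)) (dl (h - e) s).
  rewrite (vmax s sTa); have := HA s (YA s (YM s sTa)); rewrite -/h -/e ler_norml.
  by move=> /andP[? ?]; lra.
have bE : b = T - alpha by rewrite /b distrC ger0_norm// subr_ge0.
have le := @is_derive_le _ (fun s => (h + e) * s - edot q (Y s))
    (fun s => (h + e) - edot q (v s)) alpha T aT.
suff : (h + e) * alpha - edot q (Y alpha) <= (h + e) * T - edot q (Y T).
  by rewrite bE; lra.
apply: le => s saT; have /andP[as_ sT] := saT.
  exact: is_deriveB (dl (h + e) s) (dq s (le_trans a0 as_)).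
have := HA s (YA s (YM' s saT)); rewrite -/h -/e ler_norml.
have := Ham_ge F0 Fc q (dY s (le_trans a0 as_)).2.
by move=> ? /andP[? ?]; lra.
Qed.

End MinTime.

(** * Absorbing errors into a quadratic term *)

Lemma sqr_le {R : realType} (a b : R) : 0 <= a -> a <= b -> a ^+ 2 <= b ^+ 2.
Proof. by move=> a0 ab; rewrite ler_pXn2r// nnegrE (le_trans a0). Qed.

(** To be read with [d = |y - x(0)|], [b = |alpha - T|], [A] and [D] the pairings of [p(T)] with
    [Y(T) - xbar] and [Y(alpha) - Y(T)], and [G d + M b] a bound for the distance of [Y] from
    [xbar]. Mixed products are absorbed by [d b <= d^2 + b^2]. *)
Lemma quadratic_error {R : realType} (E c beta A D a k G M l d b : R) :
  0 <= k -> 0 <= a -> 0 <= G -> 0 <= M -> 0 <= l -> 0 <= d -> 0 <= b ->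
  E <= A + a * d ^+ 2 ->
  c * beta - k * (G * d + M * b) * b <= D ->
  A + D <= l * (G * d + M * b) ^+ 2 ->
  E + c * beta <= (a + k * (G + M) + 2 * l * (G ^+ 2 + M ^+ 2)) * (d ^+ 2 + b ^+ 2).
Proof.
move=> k0 a0 G0 M0 l0 d0 b0 h1 h2 h3.
have db : d * b <= d ^+ 2 + b ^+ 2.
  by have := sqr_ge0 (d - b / 2); have := sqr_ge0 b; lra.
have bb : b * b <= d ^+ 2 + b ^+ 2 by have := sqr_ge0 d; lra.
have e1 : k * (G * d + M * b) * b <= k * (G + M) * (d ^+ 2 + b ^+ 2).
  rewrite -!mulrA ler_wpM2l//.
  by have := ler_wpM2l G0 db; have := ler_wpM2l M0 bb; lra.
have e2 : l * (G * d + M * b) ^+ 2 <= 2 * l * (G ^+ 2 + M ^+ 2) * (d ^+ 2 + b ^+ 2).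
  rewrite [2 * l]mulrC -!mulrA ler_wpM2l//.
  have := sqr_ge0 (G * d - M * b); have := sqr_ge0 (G * b); have := sqr_ge0 (M * d); lra.
have e3 : a * d ^+ 2 <= a * (d ^+ 2 + b ^+ 2).
  by rewrite ler_wpM2l// lerDl sqr_ge0.
lra.
Qed.

(** If [d] or [|beta|] exceeds [r], then [r d] and [r |beta|] are both at most [d^2 + beta^2]. This
    extends a local estimate to the whole hypograph, whatever [T(y)] is. *)
Lemma linear_le_quadratic {R : realType} (E P c d beta r : R) :
  0 < r -> 0 <= P -> 0 <= d -> E <= P * d -> r < d \/ r < `|beta| ->
  E + c * beta <= (P + `|c|) / r * (d ^+ 2 + beta ^+ 2).
Proof.
move=> r0 P0 d0 EP far.
have cb : c * beta <= `|c| * `|beta| by rewrite -normrM ler_norm.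
rewrite -[beta ^+ 2]real_normK ?num_real//; have b0 := normr_ge0 beta.
have c0 := normr_ge0 c; move: `|beta| `|c| far cb b0 c0 => b k far cb b0 k0.
have [rd rb] : r * d <= d ^+ 2 + b ^+ 2 /\ r * b <= d ^+ 2 + b ^+ 2.
  have bb := sqr_ge0 b; have dd := sqr_ge0 d; have := mulr_ge0 d0 b0 => bd.
  case: far => h.
    have h1 : r * d <= d * d by rewrite ler_wpM2r// ltW.
    have h2 : r * b <= d * b by rewrite ler_wpM2r// ltW.
    split; first lra.
    by have := sqr_ge0 (d - b / 2); lra.
  have h1 : r * d <= b * d by rewrite ler_wpM2r// ltW.
  have h2 : r * b <= b * b by rewrite ler_wpM2r// ltW.
  split; last lra.
  by have := sqr_ge0 (d - b / 2); lra.
rewrite mulrAC ler_pdivlMr//.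
have := ler_wpM2l P0 rd; have := ler_wpM2l k0 rb.
have := ler_wpM2l (ltW r0) EP; have := ler_wpM2l (ltW r0) cb; lra.
Qed.

(** * Sign of the Hamiltonian at the normal, and the proximal inequality at the initial point *)

Section Main.
Context {R : realType} {n : nat}.
Local Notation V := 'rV[R]_n.
Local Notation mu := (@lebesgue_measure R).
Variables (F : V -> set V) (K c0 K1 : R) (S : set V).
Hypothesis F0 : forall y, F y !=set0.
Hypothesis Fc : forall y, compact (F y).
Hypothesis K0 : 0 < K.
Hypothesis FK : lipschitz_multi F K.

(** With [tau = T - s], the increment [edot xi (x T - x s)] is at least [- O(tau^2)] by the normal
    inequality at [x s], and at most [(h + O(tau)) tau] because velocities lie in [F]; divide by
    [tau] and let it tend to 0. *)
Lemma Ham_inner_normal_ge0 (x : R -> V) (xi : V) (T : R) : 0 < T ->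
  trajectory F x T -> (forall t, 0 < t < T -> ~ S (x t)) ->
  prox_normal (closure (~` S)) (x T) xi -> 0 <= Ham F (x T) xi.
Proof.
move=> T0 [xac xae] xS [_ [sigma sigma0 xiP]]; set h := Ham F (x T) xi.
have [B B0 xB] := abs_cont_arc_bounded (ltW T0) xac.
have [M M0 FM] := F_bounded F0 Fc 0.
pose L := M + K * B; have L0 : 0 <= L by rewrite addr_ge0// mulr_ge0// ltW.
have aeS s : 0 < s < T -> (fun t => s <= t <= T) `<=` (fun t : R => 0 <= t <= T).
  by move=> /andP[s0 _] t /= /andP[st ->]; rewrite (le_trans (ltW s0)).
have xL s : 0 < s < T -> enorm (x T - x s) <= L * (T - s).
  move=> sT; have /andP[s0 sT'] := sT.
  apply: abs_cont_arc_lipschitz (ltW sT') (abs_cont_arcS (ltW s0) (lexx T) xac) _.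
  apply: (@filterS _ _ (ae_filter_ringOfSetsType mu) _ _ _ xae) => t ht.
  rewrite in_itv/= => /(aeS s sT) t0T; have [d dx Fd] := ht t0T; exists d => //.
  apply: le_trans (F_growth FK FM Fd) _; rewrite lerD2l ler_pM2l// subr0.
  exact: xB.
pose k := K * enorm xi * L + sigma * L ^+ 2.
have k0 : 0 <= k.
  apply: addr_ge0; last by apply: mulr_ge0 => //; exact: sqr_ge0.
  by apply: mulr_ge0 => //; apply: mulr_ge0 (ltW K0) (enorm_ge0 _).
have key s : 0 < s < T -> 0 <= h + k * (T - s).
  move=> sT; have /andP[s0 sT'] := sT; have tau0 : 0 < T - s by rewrite subr_gt0.
  have h1 : edot xi (x s - x T) <= sigma * (L * (T - s)) ^+ 2.
    have /xiP : closure (~` S) (x s) by apply: subset_closure; exact: xS.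
    move=> /le_trans; apply; rewrite ler_wpM2l// sqr_le ?enorm_ge0//.
    by rewrite enormB; exact: xL.
  have h2 : edot xi (x T - x s) <= (h + K * enorm xi * (L * (T - s))) * (T - s).
    apply: abs_cont_arc_edot_le (ltW sT') (abs_cont_arcS (ltW s0) (lexx T) xac) _.
    apply: (@filterS _ _ (ae_filter_ringOfSetsType mu) _ _ _ xae) => t ht.
    rewrite in_itv/= => tsT; have [d dx Fd] := ht (aeS s sT t tsT); exists d => //.
    apply: le_trans (Ham_ge F0 Fc xi Fd) _.
    apply: le_trans (Ham_lipschitz F0 Fc FK _ (x T) xi) _; rewrite lerD2l.
    rewrite ler_wpM2l//; first by rewrite mulr_ge0 ?enorm_ge0// ltW.
    have /andP[st tT] := tsT; have [tE|tT'] := eqVneq t T.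
      by rewrite tE subrr enorm0 mulr_ge0// ltW.
    rewrite enormB; apply: le_trans (xL t _) _.
      by rewrite (lt_le_trans s0 st) lt_neqAle tT' tT.
    by rewrite ler_wpM2l// lerD2l lerN2.
  rewrite -(pmulr_lge0 _ tau0).
  have e : (h + k * (T - s)) * (T - s) =
     (h + K * enorm xi * (L * (T - s))) * (T - s) + sigma * (L * (T - s)) ^+ 2.
    by rewrite /k; ring.
  rewrite e; have -> : 0 = edot xi (x T - x s) + edot xi (x s - x T).
    by rewrite -edotDr addrC subrKA subrr edot0r.
  exact: lerD.
apply/ler_addgt0Pr => e e0.
pose tau := Num.min (T / 2) (e / (k + 1)).
have k1 : 0 < k + 1 by rewrite ltr_wpDl.
have tau0 : 0 < tau by rewrite lt_min !divr_gt0.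
have tauT : tau < T.
  apply: (@le_lt_trans _ _ (T / 2)); first by rewrite ge_min lexx.
  by rewrite ltr_pdivrMr// ltr_pMr// ltr1n.
have taue : k * tau <= e.
  apply: (@le_trans _ _ ((k + 1) * tau)); first by rewrite ler_pM2r// lerDl.
  by rewrite mulrC -ler_pdivlMr// ge_min lexx orbT.
have := key (T - tau); rewrite subr_gt0 tauT gtrDl oppr_lt0 tau0 => /(_ isT).
by rewrite subKr => /le_trans; apply; rewrite lerD2l.
Qed.

Hypothesis c00 : 0 <= c0.
Hypothesis Hsc : forall q, semiconvex (fun y => Ham F y q) (c0 * enorm q).
Hypothesis K10 : 0 <= K1.
Hypothesis Fgrad : forall q, q != 0 -> forall y, exists d, grad_at (Ham F y) q d.
Hypothesis FgradK : forall q y z dy dz, q != 0 ->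
  grad_at (Ham F y) q dy -> grad_at (Ham F z) q dz ->
  enorm (dy - dz) <= K1 * enorm (y - z).

(** Stated at the initial time only; other times follow by translating the arcs. *)
Lemma adjoint_arc_supports_min_time (x p : R -> V) (xi : V) (T l : R) : 0 < T -> 0 <= l ->
  abs_cont_arc x 0 T -> abs_cont_arc p 0 T ->
  (forall t, 0 <= t <= T -> p t != 0) ->
  {ae mu, forall t, t \in `[0, T] ->
      exists2 xd, is_derive t 1 x xd & grad_at (Ham F (x t)) (p t) xd} ->
  {ae mu, forall t, t \in `[0, T] ->
      exists2 pd, is_derive t 1 p pd &
        clarke_grad (fun y => Ham F y (p t)) (x t) (- pd)} ->
  prox_normal (closure (~` S)) (x T) xi -> p T = l *: xi ->
  exists2 sigma : R, 0 <= sigma & forall y (alpha : R), (alpha%:E <= min_time F S y)%E ->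
    edot (p 0) (y - x 0) + Ham F (x T) (p T) * (alpha - T)
      <= sigma * (enorm (y - x 0) ^+ 2 + (alpha - T) ^+ 2).
Proof.
move=> T0 l0 xac pac p0 xae pae [_ [sg sg0 xiP]] pT; have T0' := ltW T0.
have [P P0 pP] := abs_cont_arc_bounded T0' pac.
have [B B0 FB] := F_bounded F0 Fc (x T).
set c := Ham F (x T) (p T).
(* Starting points within 1 of [x 0] and times up to [T + 1] are covered, so [M] is one Lipschitz
   constant for all comparison flows. *)
pose rho := enorm (x 0 - x T) + 1.
pose M := B + K * ((rho ^+ 2 + 1) * expR (2 * (B + K) * (T + 1))).
pose G := expR (K1 * T).
have M0 : 0 <= M.
  by rewrite addr_ge0// mulr_ge0 ?ltW// mulr_gt0 ?expR_gt0// ltr_wpDl ?sqr_ge0.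
have G0 : 0 <= G := expR_ge0 _.
pose a := c0 * P * G ^+ 2 * T; pose k := K * enorm (p T).
have a0 : 0 <= a by rewrite mulr_ge0// mulr_ge0 ?sqr_ge0// mulr_ge0.
have k0 : 0 <= k by rewrite mulr_ge0 ?enorm_ge0// ltW.
have ls0 : 0 <= l * sg by rewrite mulr_ge0.
have near_est y (alpha : R) : enorm (y - x 0) <= 1 -> 0 < alpha -> alpha <= T + 1 ->
    (alpha%:E <= min_time F S y)%E ->
    edot (p 0) (y - x 0) + c * (alpha - T) <=
    (a + k * (G + M) + 2 * (l * sg) * (G ^+ 2 + M ^+ 2)) *
    (enorm (y - x 0) ^+ 2 + `|alpha - T| ^+ 2).
  move=> y1 al0 alT aly.
  (* Clamping time to [[0, T]] freezes the adjoint at [p T] and keeps it nonzero, as the flow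
     requires. *)
  have cq := abs_cont_arc_clamp T0' pac.
  have q0 s : p (clamp 0 T s) != 0 by apply: p0; exact: clamp_itv.
  have [Y [v [Y0 dY]]] := max_flow F0 Fc K10 Fgrad FgradK y cq q0.
  have FY (s : R) : 0 <= s -> is_derive s 1 Y (v s) /\ F (Y s) (v s).
    by move=> /dY[? /(grad_at_argmax F0 Fc)[? _]].
  have Yrho : enorm (Y 0 - x T) <= rho.
    by apply: le_trans (enorm_dist _ (x 0) _) _; rewrite Y0 addrC lerD2l.
  have T10 : 0 <= T + 1 by rewrite addr_ge0.
  have TT1 : T <= T + 1 by rewrite lerDl.
  have YL s t : 0 <= s -> s <= t -> t <= T + 1 -> enorm (Y t - Y s) <= M * (t - s).
    by move=> s0 st tT; exact: (flow_lipschitz K0 FK B0 T10 FB FY Yrho s0 st tT).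
  have Yac : abs_cont_arc Y 0 T.
    apply: (@lipschitz_abs_cont_arc _ _ _ _ _ M) => s t s0 st tT.
    by apply: YL => //; exact: le_trans TT1.
  have [wT adj] := @flow_adjoint_le _ _ F c0 K1 F0 Fc c00 Hsc K10 FgradK x p Y v T P T0'
    xac pac p0 pP xae pae Yac (fun t tT => ltac:(
      have /andP[t0 _] := tT; have := dY t t0; rewrite clamp_id//; exact)).
  have Ycl : closure (~` S) (Y alpha).
    apply: (closure_before_min_time (F := F) al0).
    - by move=> tau tau0; exact: (flow_trajectory F0 Fc K0 FK (ltW tau0) FY).
    - exact: is_derive_continuous (FY alpha (ltW al0)).1.
    - by rewrite Y0.
  have YT t : 0 <= t -> t <= T + 1 -> enorm (Y t - Y T) <= M * `|t - T|.
    move=> t0 tT1; have [Tt|/ltW tT] := leP T t.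
      by rewrite ger0_norm ?subr_ge0//; exact: YL.
    by rewrite enormB distrC ger0_norm ?subr_ge0//; exact: YL.
  have mono (s : R) : `|s - T| <= `|alpha - T| -> M * `|s - T| <= M * `|alpha - T|.
    by move=> ?; rewrite ler_wpM2l.
  have E := @flow_endpoint_ge _ _ F K F0 Fc K0 FK Y v (x T) (p T) T alpha M M0 T0'
    (ltW al0) FY _ _ _.
  rewrite Y0 in wT adj.
  apply: (@quadratic_error _ _ c (alpha - T) (edot (p T) (Y T - x T))
    (edot (p T) (Y alpha - Y T)) a k G M (l * sg)) => //; rewrite ?enorm_ge0 ?normr_ge0//.
  - apply: le_trans (E _ _ _).
    + rewrite lerD2l lerN2 ler_wpM2r ?normr_ge0// ler_wpM2l// lerD2r.
      exact: wT.
    + move=> s /andP[Ts sa]; have s0 := le_trans T0' Ts.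
      have [_] := grad_at_argmax F0 Fc (dY s s0).2.
      by rewrite clamp_ge.
    + move=> s /andP[Ts sa]; apply: le_trans (YT s _ _) _.
      * exact: le_trans Ts.
      * exact: le_trans alT.
      * by apply: mono; rewrite !ger0_norm ?subr_ge0 ?lerD2r// (le_trans Ts).
    + move=> s /andP[as_ sT]; apply: le_trans (YT s _ _) _.
      * exact: le_trans (ltW al0) as_.
      * exact: le_trans TT1.
      * by apply: mono; rewrite !ler0_norm ?subr_le0 ?lerN2 ?lerD2r// (le_trans as_).
  (* The two increments telescope to [Y alpha - x T], and [l >= 0] lets the normal inequality be
     multiplied by [l]. *)
  - rewrite -edotDr addrC subrKA pT edotZl -mulrA ler_wpM2l//.
    apply: le_trans (xiP _ Ycl) _; rewrite ler_wpM2l//.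
    apply: sqr_le; first exact: enorm_ge0.
    apply: le_trans (enorm_dist _ (Y T) _) _; rewrite addrC lerD//.
    by apply: YT => //; exact: ltW.
(* [r <= 1] stays within the range of [M], and [r < T] makes [alpha] positive when
   [|alpha - T| <= r]. *)
pose r := Num.min 1 T / 2.
have r0 : 0 < r by rewrite divr_gt0// lt_min T0 ltr01.
have r1 : r <= 1.
  by rewrite ler_pdivrMr// mul1r (@le_trans _ _ 1)// ?ge_min ?lexx// ler1n.
have rT : r < T.
  rewrite ltr_pdivrMr// (@le_lt_trans _ _ T)// ?ge_min ?lexx ?orbT//.
  by rewrite ltr_pMr// ltr1n.
pose N := a + k * (G + M) + 2 * (l * sg) * (G ^+ 2 + M ^+ 2).
have N0 : 0 <= N.
  apply: addr_ge0.
    by apply: addr_ge0 => //; apply: mulr_ge0 => //; exact: addr_ge0.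
  apply: mulr_ge0; first exact: mulr_ge0.
  by apply: addr_ge0; exact: sqr_ge0.
have N'0 : 0 <= (P + `|c|) / r.
  by apply: divr_ge0; [exact: addr_ge0|exact: ltW].
(* The near constant plus the far one: both are nonnegative, so either estimate weakens to the
   sum. *)
exists (N + (P + `|c|) / r); first exact: addr_ge0.
move=> y alpha aly; rewrite mulrDl.
have sq0 : 0 <= enorm (y - x 0) ^+ 2 + (alpha - T) ^+ 2.
  by apply: addr_ge0; exact: sqr_ge0.
have [yr|yr] := leP (enorm (y - x 0)) r; last first.
  rewrite ler_wpDl ?mulr_ge0//; apply: linear_le_quadratic; rewrite ?enorm_ge0//; last by left.
  by apply: le_trans (edot_le _ _) _; rewrite ler_wpM2r ?enorm_ge0// pP// lexx.
have [ar|ar] := leP `|alpha - T| r; last first.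
  rewrite ler_wpDl ?mulr_ge0//; apply: linear_le_quadratic; rewrite ?enorm_ge0//; last by right.
  by apply: le_trans (edot_le _ _) _; rewrite ler_wpM2r ?enorm_ge0// pP// lexx.
apply: ler_wpDr; first exact: mulr_ge0.
rewrite -[(alpha - T) ^+ 2]real_normK ?num_real//.
move: ar; rewrite ler_norml => /andP[ar1 ar2].
apply: near_est => //; first exact: le_trans r1.
  by rewrite -(ltrD2r (- T)) sub0r; apply: lt_le_trans ar1; rewrite ltrN2.
by rewrite -lerBlDl (le_trans ar2).
Qed.

End Main.

Theorem theorem4p1 (R : realType) (n : nat) (F : 'rV[R]_n -> set 'rV[R]_n)
  (K c0 K1 : R) (S : set 'rV[R]_n) (x : 'rV[R]_n) (Tx : R)
  (xt p : R -> 'rV[R]_n) (xi : 'rV[R]_n) :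
  (forall y, F y !=set0) ->
  (forall y, convex_set_rV (F y)) ->
  (forall y, compact (F y)) ->
  0 < K -> lipschitz_multi F K ->
  (* (H1) *)
  0 <= c0 ->
  (forall q, semiconvex (fun y => Ham F y q) (c0 * enorm q)) ->
  (* (H2) *)
  0 <= K1 ->
  (forall q, q != 0 -> forall y, exists d, grad_at (Ham F y) q d) ->
  (forall q y z dy dz, q != 0 -> grad_at (Ham F y) q dy -> grad_at (Ham F z) q dz ->
     enorm (dy - dz) <= K1 * enorm (y - z)) ->
  closed S ->
  ~ S x ->
  min_time F S x = Tx%:E ->
  (* optimal trajectory *)
  trajectory F xt Tx -> xt 0 = x -> S (xt Tx) ->
  (* unit proximal inner normal *)
  prox_normal (closure (~` S)) (xt Tx) xi -> enorm xi = 1 ->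
  (* adjoint arc *)
  abs_cont_arc p 0 Tx ->
  (forall t, 0 <= t <= Tx -> p t != 0) ->
  {ae (@lebesgue_measure R), forall t, t \in `[0, Tx] ->
      exists2 xd, is_derive t 1 xt xd & grad_at (Ham F (xt t)) (p t) xd} ->
  {ae (@lebesgue_measure R), forall t, t \in `[0, Tx] ->
      exists2 pd, is_derive t 1 p pd &
        clarke_grad (fun y => Ham F y (p t)) (xt t) (- pd)} ->
  ((Ham F (xt Tx) xi != 0 -> p Tx = (Ham F (xt Tx) xi)^-1 *: xi ->
      forall t, 0 <= t < Tx -> prox_supergrad (min_time F S) (xt t) (- p t)) /\
   (Ham F (xt Tx) xi = 0 -> p Tx = xi ->
      forall t, 0 <= t < Tx -> hzn_prox_supergrad (min_time F S) (xt t) (- p t))).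
Proof.
move=> F0 _ Fc K0 FK c00 Hsc K10 Fgrad FgradK _ _ Tmin xtr x0 SxT xin _ pac p0 xae pae.
have xtmin : min_time F S (xt 0) = Tx%:E by rewrite x0.
(* Translating time by [t] makes [xt t] the initial point, with minimum time [Tx - t], and leaves
   the endpoint, [xi] and [p Tx] unchanged. *)
have main t (l : R) : 0 <= t < Tx -> 0 <= l -> p Tx = l *: xi ->
    min_time F S (xt t) = (Tx - t)%:E /\
    prox_normal2 (hypo (min_time F S)) (xt t, Tx - t) (p t, Ham F (xt Tx) (p Tx)).
  move=> tT l0 pTx; have /andP[t0 tT'] := tT.
  have tmin := min_time_along xtr SxT xtmin tT; split=> //; split.
    by rewrite /hypo /= tmin.
  have tTE : t + (Tx - t) = Tx by rewrite addrC subrK.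
  have shift_ae (P : R -> Prop) :
      {ae (@lebesgue_measure R), forall s, s \in `[0, Tx] -> P s} ->
      {ae (@lebesgue_measure R), forall s, s \in `[0, Tx - t] -> P (t + s)}.
    move=> /(ae_shift t); apply: (@filterS _ _ (ae_filter_ringOfSetsType _)) => s Ps.
    rewrite in_itv/= => /andP[s0 sT]; apply: Ps.
    by rewrite in_itv/= addr_ge0// -lerBrDl.
  have arc_shift f : abs_cont_arc f 0 Tx -> abs_cont_arc (fun s => f (t + s)) 0 (Tx - t).
    by move=> fac; apply: abs_cont_arc_shift; apply: abs_cont_arcS fac; rewrite ?addr0 ?tTE.
  have := @adjoint_arc_supports_min_time R n F K c0 K1 S F0 Fc K0 FK c00 Hsc K10 Fgrad FgradK
    (fun s => xt (t + s)) (fun s => p (t + s)) xi (Tx - t) l.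
  rewrite !addr0 !tTE subr_gt0 => h.
  have [||||||//|sg sg0 sgP] := h tT' l0.
  - by apply: arc_shift; case: xtr.
  - exact: arc_shift.
  - by move=> s /andP[s0 sT]; apply: p0; rewrite addr_ge0//= -lerBrDl.
  - apply: (@filterS _ _ (ae_filter_ringOfSetsType _) _ _ _ (shift_ae _ xae)) => s xs.
    by move=> /xs[d dx gx]; exists d => //; exact: is_derive_shiftl.
  - apply: (@filterS _ _ (ae_filter_ringOfSetsType _) _ _ _ (shift_ae _ pae)) => s ps.
    by move=> /ps[d dp gp]; exists d => //; exact: is_derive_shiftl.
  - exact: xin.
  by exists sg => // -[y alpha] /= ya; exact: sgP.
split=> [h0 pT t tT|h0 pT t tT].
  have Tx0 : 0 < Tx by move: tT => /andP[/le_lt_trans]; apply.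
  (* This makes [l], the inverse of [Ham F (xt Tx) xi], nonnegative. The arc avoids [S] before [Tx]
     by optimality. *)
  have h_ge0 : 0 <= Ham F (xt Tx) xi.
    apply: (Ham_inner_normal_ge0 F0 Fc K0 FK Tx0 xtr _ xin) => s /andP[s0 sT] Ss.
    have := min_time_le s0 (trajectoryS (ltW sT) xtr) Ss.
    by rewrite xtmin lee_fin leNgt sT.
  have [|tmin tP] := main t _ tT _ pT; first by rewrite invr_ge0.
  rewrite /prox_supergrad /= tmin; split => //=.
  (* Positive homogeneity of the Hamiltonian in [p] turns the last component of the normal into
     1. *)
  by move: tP; rewrite pT HamZ ?invr_ge0// mulVf// opprK.
have [|tmin tP] := main t 1 tT ler01 _; first by rewrite scale1r.
rewrite /hzn_prox_supergrad /= tmin; split => //=.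
by move: tP; rewrite pT h0 opprK.
Qed.
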